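(* Let $N\ge 7$, let $R>0$ and let $B_R=B(0,R)\subset\mathbb{R}^N$. Put $2^*=\frac{2N}{N-2}$. Let $(p_k)_{k\ge0}$ be a sequence of real numbers with $p_k\ge 2^*$ for all $k\ge 0$ and $\lim_{k\to+\infty}p_k=2^*$. Let $(u_k)_{k\ge0}$ be a sequence of radial, possibly sign-changing, functions in $C^2(\overline{B_R})$ such that for all $k\ge 0$ $$-\Delta u_k+u_k=|u_k|^{p_k-2}u_k \ \text{ in } B_R,\qquad \partial_\nu u_k=0\ \text{ on }\partial B_R,$$ and assume that there is a constant $C>0$ such that $\|u_k\|_{L^{\alpha_k}(B_R)}\le C$ for all $k\ge0$, where $\alpha_k=\max\left(2^*,\frac N2 p_k-N\right)$. Then $(u_k)_{k\ge0}$ is precompact in $C^2(\overline{B_R})$.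
   Context: $\Delta=\sum_i\partial_{x_i}^2$ and $\partial_\nu$ is the outward normal derivative on $\partial B_R$. A sequence is precompact in $C^2(\overline{B_R})$ if each of its subsequences has a further subsequence converging in $C^2(\overline{B_R})$. *)

(* Defs.v *)
From HB Require Import structures.
From mathcomp Require Import all_boot all_order all_algebra.
From mathcomp Require Import all_classical all_reals all_analysis.
Set Implicit Arguments.
Unset Strict Implicit.
Unset Printing Implicit Defensive.
Import Order.TTheory GRing.Theory Num.Theory.
Import numFieldNormedType.Exports.
Local Open Scope classical_set_scope.
Local Open Scope ring_scope.

Section euclidean_balls.
Context {R : realType} {N : nat}.
Implicit Types (x : 'rV[R]_N) (r : R).

(* The library norm of 'rV[R]_N is the sup norm, which induces the same topology
   but has cubes as balls. *)
Definition enorm x : R := Num.sqrt (\sum_i x 0 i ^+ 2).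

Definition oball r : set 'rV[R]_N := [set x | enorm x < r].
Definition cball r : set 'rV[R]_N := [set x | enorm x <= r].
Definition esphere r : set 'rV[R]_N := [set x | enorm x = r].

End euclidean_balls.

Section C2.
Context {R : realType} {N : nat}.
Implicit Types (u v f : 'rV[R]_N -> R) (r : R).

Definition partial (i : 'I_N) f : 'rV[R]_N -> R := 'D_(delta_mx 0 i) f.

Definition laplacian f : 'rV[R]_N -> R :=
  fun x => \sum_i partial i (partial i f) x.

Definition extends_continuously r f :=
  exists2 g : 'rV[R]_N -> R,
    {within cball r, continuous g} & forall x, oball r x -> g x = f x.

(* Functions are total, but only their values on the closed ball matter:
   partial derivatives are taken at points of the open ball only. *)
Definition C2_cball r u : Prop :=
  [/\ {within cball r, continuous u},
      forall x i, oball r x -> derivable u x (delta_mx 0 i),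
      forall x i j, oball r x -> derivable (partial i u) x (delta_mx 0 j),
      forall i, extends_continuously r (partial i u) &
      forall i j, extends_continuously r (partial j (partial i u))].

(* Boundary value, taken from inside the ball: on a function satisfying
   extends_continuously this is the continuous extension. *)
Definition trace r f : 'rV[R]_N -> R :=
  fun x => lim (f y @[y --> within (oball r) (nbhs x)]).

(* The outward unit normal at a point x of the sphere of radius r is x / r. *)
Definition normal_derivative r u : 'rV[R]_N -> R :=
  fun x => \sum_i trace r (partial i u) x * (x 0 i / r).

Definition radial r u : Prop :=
  forall x y, cball r x -> cball r y -> enorm x = enorm y -> u x = u y.

(* A finite supremum for the differences of C2_cball functions used below; by
   continuity, passing to the closed ball would not change it. *)
Definition sup_norm r f : R := sup [set `|f x| | x in oball r].

Definition C2_norm r u : R :=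
  sup_norm r u + \sum_i sup_norm r (partial i u)
  + \sum_i \sum_j sup_norm r (partial j (partial i u)).

Definition C2_cvg r (u_ : nat -> 'rV[R]_N -> R) v : Prop :=
  C2_cball r v /\ C2_norm r (u_ k \- v) @[k --> \oo] --> (0 : R).

Definition C2_precompact r (u_ : nat -> 'rV[R]_N -> R) : Prop :=
  forall phi : nat -> nat, increasing_seq phi ->
  exists2 psi : nat -> nat, increasing_seq psi &
    exists v, C2_cvg r (u_ \o phi \o psi) v.

End C2.

(* The Lebesgue measure on R^n, with R^n represented by the measurable type of
   n-tuples: the n-fold product of the Lebesgue measure on the line, carried from
   R * R^n to R^n.+1 by tuple_cons. *)
Section lebesgue_measure_on_tuples.
Context {R : realType}.
Local Notation T := (measurableTypeR R).
Local Open Scope ereal_scope.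

Definition tuple_cons n (p : T * n.-tuple T) : n.+1.-tuple T :=
  [tuple of p.1 :: p.2].

Lemma measurable_tuple_cons n :
  measurable_fun [set: T * n.-tuple T] (@tuple_cons n).
Proof. exact: measurable_cons. Qed.

Section step.
Context n (mu : {sigma_finite_measure set (n.-tuple T) -> \bar R}).

Definition lebesgue_step : set (n.+1.-tuple T) -> \bar R :=
  pushforward (lebesgue_measure \x mu) (@tuple_cons n).

Let lebesgue_step0 : lebesgue_step set0 = 0.
Proof. by rewrite /lebesgue_step /pushforward preimage_set0 measure0. Qed.

Let lebesgue_step_ge0 A : 0 <= lebesgue_step A.
Proof. by apply: integral_ge0 => x _; exact: measure_ge0. Qed.

Let lebesgue_step_semi_sigma_additive : semi_sigma_additive lebesgue_step.
Proof.
move=> F mF tF mUF; rewrite /lebesgue_step /pushforward preimage_bigcup.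
have mpre A : measurable A -> measurable (@tuple_cons n @^-1` A).
  by move=> mA; rewrite -[X in measurable X]setTI; exact: measurable_tuple_cons.
apply: measure_semi_sigma_additive.
- by move=> i; exact: mpre.
- apply/trivIsetP => /= i j _ _ ij; rewrite -preimage_setI.
  by move/trivIsetP : tF => /(_ _ _ _ _ ij) ->//; rewrite preimage_set0.
- by rewrite -preimage_bigcup; exact: mpre.
Qed.

HB.instance Definition _ := isMeasure.Build _ _ _ lebesgue_step
  lebesgue_step0 lebesgue_step_ge0 lebesgue_step_semi_sigma_additive.

Let tuple_uncons (t : n.+1.-tuple T) : T * n.-tuple T :=
  (thead t, [tuple of behead t]).

Let measurable_tuple_uncons : measurable_fun setT tuple_uncons.
Proof.
apply/measurable_fun_pairP; split; first exact: measurable_tnth.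
exact: measurable_behead.
Qed.

Let lebesgue_step_sigma_finite : sigma_finite setT lebesgue_step.
Proof.
have /sigma_finiteP[F [TF ndF Foo]] := sigma_finiteT (@lebesgue_measure R).
have /sigma_finiteP[G [TG ndG Goo]] := sigma_finiteT mu.
exists (fun i => tuple_uncons @^-1` (F i `*` G i)).
  rewrite -preimage_bigcup (_ : \bigcup_i _ = setT) ?preimage_setT//.
  rewrite -subTset => -[x t] _.
  have [i _ Fix] : (\bigcup_i F i) x by rewrite -TF.
  have [j _ Gjt] : (\bigcup_i G i) t by rewrite -TG.
  exists (maxn i j) => //; split.
    by move: x Fix; exact/subsetPset/ndF/leq_maxl.
  by move: t Gjt; exact/subsetPset/ndG/leq_maxr.
move=> i; have [mFi Fioo] := Foo i; have [mGi Gioo] := Goo i.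
have mFG : measurable (F i `*` G i) by exact: measurableX.
split.
  by rewrite -[X in measurable X]setTI; exact: measurable_tuple_uncons.
rewrite /lebesgue_step /pushforward -comp_preimage.
rewrite (_ : tuple_uncons \o _ = id); last first.
  by apply/funext => -[x t]; congr pair; exact/val_inj.
by rewrite preimage_id product_measure1E// lte_mul_pinfty// ge0_fin_numE.
Qed.

HB.instance Definition _ := Measure_isSigmaFinite.Build _ _ _ lebesgue_step
  lebesgue_step_sigma_finite.

End step.

Fixpoint lebesgue_tuple n : {sigma_finite_measure set (n.-tuple T) -> \bar R} :=
  if n is n'.+1 then lebesgue_step (lebesgue_tuple n')
  else \d_([tuple] : 0.-tuple T).

End lebesgue_measure_on_tuples.

Definition Lnorm_ball {R : realType} {N : nat} (r p : R) (u : 'rV[R]_N -> R) :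
    \bar R :=
  Lnorm (@lebesgue_tuple R N) p%:E
    (fun t => ((u \_ (oball r)) (\row_i tnth t i))%:E).

Definition sobolev_exponent {R : realType} (N : nat) : R :=
  (2 * N%:R) / (N%:R - 2).

Definition alpha {R : realType} (N : nat) (p : R) : R :=
  Num.max (sobolev_exponent N) (N%:R / 2 * p - N%:R).

(* Main.v *)
Require Import Defs.
From mathcomp Require Import all_boot all_order all_algebra.
From mathcomp Require Import all_classical all_reals all_analysis measurable_realfun.
From mathcomp Require Import ring lra zify.
Set Implicit Arguments.
Unset Strict Implicit.
Unset Printing Implicit Defensive.
Import Order.TTheory GRing.Theory Num.Theory.
Import numFieldNormedType.Exports.
Local Open Scope classical_set_scope.
Local Open Scope ring_scope.

(* Write u(x) = w(|x|) and N = k + 2. The Pohozaev function P of w vanishes at 0 and,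
   as p >= 2^*, satisfies P' <= - s^(N-1) w^2. Hence P <= 0, which yields
   |s w'| <= K |w| (so a Harnack inequality) and, for s <= t,
   t^(N-2) w(t)^2 >= c s^N w(s)^2.
   Call s a bubble if s^2 |w(s)|^(p-2) >= 1/32. As alpha = N/2 (p-2) is the scale
   invariant exponent, each bubble carries a fixed amount of the integral of
   |u|^alpha on the shell s/2 < |x| < s; so the L^alpha bound limits the number of
   bubbles at dyadically separated radii.
   A large |w(0)| produces a bubble at a small radius, and a bubble at a small
   radius s forces another one between 2s and any fixed d. Otherwise w would decay
   on [2s, d] almost like the fundamental solution plus a constant, and at
   t = sqrt s this contradicts the lower bound above: there c s^N w(s)^2 compares
   like s^2 with a right-hand side of order s^((N-2)/2), and (N-2)/2 > 2 as N > 6.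
   So |w(0)| is bounded. Along a subsequence w(0) and p converge, and Gronwall's
   inequality makes the solutions a Cauchy sequence in C^2. *)

(** * Derivatives *)

(** Why [sqrt s]: put k = N - 2, let p be close to critical and let s be a small bubble, so that
    w(s)^2 is at least about s^(-k). The Pohozaev loss gives w(t)^2 >= c s^(k+2) t^(-k) w(s)^2. In a
    gap without bubbles w(t)^2 is at most a bounded term plus a multiple of (s/t)^(2k) w(s)^2, up to
    small losses in the exponents. The second term is absorbed as soon as t is much larger than s^(1
    - 2/k), and the bounded term is too small if t is much smaller than s^(2/k). Such t exist
    exactly when k > 4, and [sqrt s] is the geometric mean of the two thresholds. The loss comes
    from the linear term +u of the equation: its L^2 mass near the bubble forces P away from 0,
    while supercriticality gives the other term of P' the right sign. The exponents suffer a loss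
    because the bubble threshold is a fixed positive number, which perturbs the characteristic
    exponents 0 and -k of the radial Laplacian in ln s. *)

Section calculus.
Context {R : realType}.
Implicit Types (f g df : R -> R) (x a b : R).

Lemma is_derive_add f g x a b : is_derive x 1 f a -> is_derive x 1 g b ->
  is_derive x 1 (fun y => f y + g y) (a + b).
Proof. by move=> ? ?; exact: is_deriveD. Qed.

Lemma is_derive_opp f x a : is_derive x 1 f a ->
  is_derive x 1 (fun y => - f y) (- a).
Proof. by move=> ?; exact: is_deriveN. Qed.

Lemma is_derive_sub f g x a b : is_derive x 1 f a -> is_derive x 1 g b ->
  is_derive x 1 (fun y => f y - g y) (a - b).
Proof. by move=> ? ?; exact: is_deriveB. Qed.

Lemma is_derive_mul f g x a b : is_derive x 1 f a -> is_derive x 1 g b ->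
  is_derive x 1 (fun y => f y * g y) (f x * b + g x * a).
Proof. by move=> ? ?; exact: is_deriveM. Qed.

Lemma is_derive_scale (c : R) f x a : is_derive x 1 f a ->
  is_derive x 1 (fun y => c * f y) (c * a).
Proof. by move=> ?; exact: is_deriveZ. Qed.

Lemma is_derive_exp n f x a : is_derive x 1 f a ->
  is_derive x 1 (fun y => f y ^+ n) (n%:R * f x ^+ n.-1 * a).
Proof.
move=> h; have := is_deriveX n h; rewrite /GRing.scale/=.
by congr (is_derive _ _ _ _); apply/funext => y; rewrite exprfctE.
Qed.

Lemma is_derive_compose f g x a b : is_derive x 1 g b ->
  is_derive (g x) 1 f a -> is_derive x 1 (fun y => f (g y)) (a * b).
Proof. by move=> hg hf; exact: is_derive1_comp. Qed.

Lemma is_derive_ident x : is_derive x 1 (fun y : R => y) 1.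
Proof. exact: is_derive_id. Qed.

Lemma is_derive_const (c : R) x : is_derive x 1 (fun=> c) 0.
Proof. exact: is_derive_cst. Qed.

Lemma is_derive_cast f x a b : is_derive x 1 f a -> a = b -> is_derive x 1 f b.
Proof. by move=> + <-. Qed.

Lemma is_derive_continuous f x a : is_derive x 1 f a -> {for x, continuous f}.
Proof. by move=> h; apply/differentiable_continuous/derivable1_diffP. Qed.

Lemma ler0_is_derive_le f df a b : a <= b ->
  (forall x, a <= x <= b -> is_derive x 1 f (df x)) ->
  (forall x, a < x < b -> df x <= 0) -> f b <= f a.
Proof.
move=> ab dfE df0.
have ab' x : x \in `]a, b[%R -> a <= x <= b.
  by rewrite in_itv => /andP[/ltW-> /ltW->].
apply: (@ler0_derive1_le_cc _ f a b); rewrite ?in_itv/= ?lexx ?ab//.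
- by move=> x /ab' /dfE h; exact: ex_derive.
- move=> x xab; have h := dfE _ (ab' _ xab).
  by rewrite derive1E (@derive_val _ _ _ _ _ _ _ h); apply: df0; rewrite in_itv in xab.
- by apply: derivable_within_continuous => x; rewrite in_itv => /dfE h; exact: ex_derive.
Qed.

Lemma ger0_is_derive_le f df a b : a <= b ->
  (forall x, a <= x <= b -> is_derive x 1 f (df x)) ->
  (forall x, a < x < b -> 0 <= df x) -> f a <= f b.
Proof.
move=> ab dfE df0; rewrite -lerN2.
apply: (@ler0_is_derive_le (fun x => - f x) (fun x => - df x)) => // x xab.
  exact/is_derive_opp/dfE.
by rewrite oppr_le0 df0.
Qed.

End calculus.

Section derivative_estimates.
Context {R : realType}.

(** An epsilon-delta form with a non-strict bound, convenient at the singular point of [|y|^p], for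
    restriction to lines and for passing to limits. *)
Lemma is_derive_epsP (V : normedModType R) (f : V -> R) (x v : V) (a : R) :
  is_derive x v f a <->
  (forall e, 0 < e -> exists2 d, 0 < d & forall h, 0 < `|h| < d ->
     `|h^-1 * (f (h *: v + x) - f x) - a| <= e).
Proof.
split=> [fa e e0|H].
  have dfx : derivable f x v by exact: ex_derive.
  have /cvgrPdist_le /(_ _ e0) [d /= d0 Hd] :
      h^-1 *: (f (h *: v + x) - f x) @[h --> 0^'] --> a.
    by rewrite -(@derive_val _ _ _ _ _ _ _ fa); exact: dfx.
  exists d => // h /andP[h0 hd]; rewrite distrC; apply: Hd => /=.
    by rewrite sub0r normrN.
  by rewrite -normr_gt0.
have fa : h^-1 *: (f (h *: v + x) - f x) @[h --> 0^'] --> a.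
  apply/cvgrPdist_le => e e0; have [d d0 Hd] := H _ e0.
  exists d => // h /= hd h0; rewrite distrC; apply: Hd.
  by rewrite normr_gt0 h0 -[X in X < _]normrN -sub0r.
by apply: DeriveDef; [apply/cvg_ex; exists a|exact: cvg_lim].
Qed.

(* On negative reals [powR] is the junk value 1, hence the absolute value; since
   1 < p the derivative also exists at 0. *)
Lemma is_derive_abs_powR (p x : R) : 1 < p ->
  is_derive x 1 (fun y => `|y| `^ p) (p * (`|x| `^ (p - 2) * x)).
Proof.
move=> p1; have [x0|x0|->] := ltgtP x 0.
- apply: (@near_eq_is_derive _ _ _ (fun y => (- y) `^ p)) => //.
  + near=> y; rewrite ltr0_norm//; near: y; exact: lt_nbhsl.
  + have := is_derive_compose (is_derive_opp (is_derive_ident x)) (@is_derive1_powR _ p (- x) _).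
    rewrite oppr_gt0 => /(_ x0); congr (is_derive _ _ _ _).
    rewrite ltr0_norm// (_ : p - 1 = p - 2 + 1); last by ring.
    rewrite powRD; last by rewrite oppr_eq0 (lt_eqF x0) implybT.
    by rewrite powRr1 ?oppr_ge0 ?ltW//; ring.
- apply: (@near_eq_is_derive _ _ _ (fun y => y `^ p)) => //.
  + near=> y; rewrite gtr0_norm//; near: y; exact: lt_nbhsr.
  + have := @is_derive1_powR _ p x x0; congr (is_derive _ _ _ _).
    rewrite gtr0_norm// (_ : p - 1 = p - 2 + 1); last by ring.
    rewrite powRD; last by rewrite (gt_eqF x0) implybT.
    by rewrite powRr1 ?ltW//; ring.
- rewrite !mulr0; apply/is_derive_epsP => e e0.
  have p10 : 0 < p - 1 by lra.
  have pn0 : p - 1 != 0 by rewrite gt_eqF.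
  (* At 0 the difference quotient has absolute value [|h|^(p-1)], which is at most [e] up to this
     radius. *)
  exists (e `^ (p - 1)^-1); first exact: powR_gt0.
  move=> h /andP[h0 hd]; rewrite addr0 /GRing.scale/= mulr1 normr0 powR0 ?subr0; last by lra.
  rewrite normrM normfV (ger0_norm (powR_ge0 _ _)).
  rewrite -(@mulr_powRB1 _ `|h|) //; last by lra.
  rewrite mulKf ?gt_eqF//.
  rewrite [leRHS](_ : e = (e `^ (p - 1)^-1) `^ (p - 1)); last first.
    by rewrite -powRrM mulVf// powRr1// ltW.
  by rewrite ge0_ler_powR ?nnegrE ?powR_ge0// ltW.
Unshelve. all: by end_near. Qed.

End derivative_estimates.

(** * The Pohozaev function *)

(* [is_derive] is a type class: instance resolution is switched off so that the
   derivatives come out in the shape given by the lemmas above. *)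
Ltac derive :=
  repeat first
  [ eassumption
  | notypeclasses refine (is_derive_add _ _)
  | notypeclasses refine (is_derive_sub _ _)
  | notypeclasses refine (is_derive_opp _)
  | notypeclasses refine (is_derive_const _ _)
  | notypeclasses refine (is_derive_ident _)
  | notypeclasses refine (is_derive_scale _ _)
  | notypeclasses refine (is_derive_exp _ _)
  | notypeclasses refine (is_derive_mul _ _) ].

Ltac derive_eq := notypeclasses refine (is_derive_cast _ _); [derive | cbv beta].

Section powR_extra.
Context {R : realType}.

Lemma abs_powR_split (p x : R) : 0 < p -> `|x| `^ p = `|x| `^ (p - 2) * x ^+ 2.
Proof.
move=> p0; have [->|x0] := eqVneq x 0.
  by rewrite normr0 powR0 ?gt_eqF// expr0n/= mulr0.
rewrite -[x ^+ 2]real_normK ?num_real// -powR_mulrn// -powRD; last first.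
  by rewrite normr_eq0 x0 implybT.
by congr powR; ring.
Qed.

Lemma ler_gt0_powR2r (a x y : R) : 0 < a -> 0 <= x -> 0 <= y ->
  (x `^ a <= y `^ a) = (x <= y).
Proof.
move=> a0 x0 y0; apply/idP/idP.
  by rewrite leNgt; apply: contraTT; rewrite negbK -ltNge; apply: gt0_ltr_powR; rewrite ?nnegrE.
by move=> xy; rewrite ge0_ler_powR ?nnegrE// ltW.
Qed.

Lemma is_derive_abs_powR_comp (p : R) (f : R -> R) (x a : R) : 1 < p ->
  is_derive x 1 f a ->
  is_derive x 1 (fun y => `|f y| `^ p) (p * (`|f x| `^ (p - 2) * f x) * a).
Proof.
move=> p1 fa; apply: (is_derive_compose (f := fun z => `|z| `^ p) fa).
exact: is_derive_abs_powR.
Qed.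

Lemma is_derive_powR_ident (a x : R) : 0 < x ->
  is_derive x 1 (fun y : R => y `^ a) (a * x `^ a / x).
Proof.
move=> x0; apply: is_derive_eq; first exact: is_derive1_powR.
rewrite powRD; last by rewrite (gt_eqF x0) implybT.
by rewrite powR_inv1 ?ltW// mulrA.
Qed.

End powR_extra.

(* The profile of a radial solution in dimension k + 2; the first line is
   stated with two-sided derivatives, the profile being extended evenly. *)
Record radial_solution {R : realType} (k : nat) (r p : R) (w w1 w2 : R -> R) :
    Prop := RadialSolution {
  rs_der1 : forall s, 0 <= s < r -> is_derive s 1 w (w1 s) ;
  rs_der2 : forall s, 0 <= s < r -> is_derive s 1 w1 (w2 s) ;
  rs_der1_0 : w1 0 = 0 ;
  rs_ode : forall s, 0 < s < r ->
    s * w2 s = s * (w s - `|w s| `^ (p - 2) * w s) - (k%:R + 1) * w1 s }.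

Section pohozaev.
Context {R : realType} (k : nat) (r p : R) (w w1 w2 : R -> R).
Hypothesis k_gt0 : (0 < k)%N.
Hypothesis p_crit : 2 * (k%:R + 2) / k%:R <= p.
Hypothesis sol : radial_solution k r p w w1 w2.
Local Notation g s := (`|w s| `^ (p - 2) * w s).

Let k0 : 0 < k%:R :> R. Proof. by rewrite ltr0n. Qed.

Lemma gt2_supercritical : 2 < p.
Proof.
apply: lt_le_trans p_crit; rewrite ltr_pdivlMr//.
by lra.
Qed.

Let p1 : 1 < p. Proof. by have := gt2_supercritical; lra. Qed.
Let p0 : 0 < p. Proof. by have := gt2_supercritical; lra. Qed.

Let wg s : `|w s| `^ p = g s * w s.
Proof. by rewrite abs_powR_split// -mulrA. Qed.

Definition energy s := w1 s ^+ 2 / 2 - w s ^+ 2 / 2 + `|w s| `^ p / p.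

(** The flux through the sphere of radius s, up to the area of the unit sphere, when the equation is
    tested with x . grad u + (N-2)/2 u; here (N-2)/2 = k/2. *)
Definition pohozaev s := s ^+ k.+1 * (s * energy s + k%:R / 2 * (w s * w1 s)).

Let w2E s : 0 < s < r -> w2 s = (w s - g s) - (k%:R + 1) * w1 s / s.
Proof.
move=> sr; have /andP[s0 _] := sr; have sn0 : s != 0 by rewrite gt_eqF.
by apply: (mulfI sn0); rewrite (rs_ode sol sr); field.
Qed.

Lemma is_derive_energy s : 0 <= s < r ->
  is_derive s 1 energy (w1 s * (w2 s - w s + g s)).
Proof.
move=> sr; have d1 := rs_der1 sol sr; have d2 := rs_der2 sol sr.
have dF := is_derive_abs_powR_comp p1 d1.
rewrite /energy; derive_eq.
by field; rewrite gt_eqF.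
Qed.

(** The first-order term of the equation acts as friction and dissipates [energy] at the rate (k+1)
    w'^2 / s. *)
Lemma energy_le0 s : 0 <= s < r -> energy s <= energy 0.
Proof.
move=> /andP[s0 sr].
apply: (@ler0_is_derive_le _ energy (fun s => w1 s * (w2 s - w s + g s))) => //.
  by move=> x /andP[x0 xs]; apply: is_derive_energy; rewrite x0 (le_lt_trans xs).
move=> x /andP[x0 xs] /=; rewrite w2E; last by rewrite x0 (lt_trans xs).
rewrite [leLHS](_ : _ = - ((k%:R + 1) * w1 x ^+ 2 / x)); last by field; rewrite gt_eqF.
by rewrite oppr_le0 divr_ge0 ?(ltW x0)// mulr_ge0 ?sqr_ge0// addr_ge0 ?(ltW k0).
Qed.

Lemma is_derive_pohozaev s : 0 <= s < r -> is_derive s 1 pohozaev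
  ((k%:R + 1) * s ^+ k * (s * energy s + k%:R / 2 * (w s * w1 s))
   + s ^+ k.+1 * (energy s + s * (w1 s * (w2 s - w s + g s))
                  + k%:R / 2 * (w1 s ^+ 2 + w s * w2 s))).
Proof.
move=> sr; have d1 := rs_der1 sol sr; have d2 := rs_der2 sol sr.
have dE := is_derive_energy sr.
rewrite /pohozaev; derive_eq.
by rewrite /= -natr1; ring.
Qed.

(** By the equation the derivative of [pohozaev] is - s^(k+1) w^2 - (k/2 - (k+2)/p) s^(k+1) |w|^p.
    The last coefficient is nonnegative exactly when p is at least critical, so the w^2 term alone
    bounds the loss. *)
Lemma pohozaev_drop a b c : 0 <= a -> a <= b -> b < r ->
  (forall s, a < s < b -> c <= s ^+ k.+1 * w s ^+ 2) ->
  pohozaev b <= pohozaev a - c * (b - a).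
Proof.
move=> a0 ab br hc; rewrite -subr_ge0.
have : pohozaev b + c * b <= pohozaev a + c * a.
  apply: (@ler0_is_derive_le _ (fun s => pohozaev s + c * s) (fun s =>
    (k%:R + 1) * s ^+ k * (s * energy s + k%:R / 2 * (w s * w1 s))
   + s ^+ k.+1 * (energy s + s * (w1 s * (w2 s - w s + g s))
                  + k%:R / 2 * (w1 s ^+ 2 + w s * w2 s)) + c * 1)) => //.
    move=> x /andP[ax xb].
    have xr : 0 <= x < r by rewrite (le_trans a0)// (le_lt_trans xb).
    exact: is_derive_add (is_derive_pohozaev xr) (is_derive_scale c (is_derive_ident x)).
  move=> x axb; have /andP[ax xb] := axb; have x0 := le_lt_trans a0 ax.
  have {}hc := hc _ axb.
  rewrite w2E; last by rewrite x0 (lt_trans xb).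
  rewrite [leLHS](_ : _ = c - x ^+ k.+1 * w x ^+ 2
     - (k%:R / 2 - (k%:R + 2) / p) * (x ^+ k.+1 * `|w x| `^ p)); last first.
    rewrite /energy wg (exprS x k); set X := x ^+ k; set G := _ `^ _.
    by field; rewrite !gt_eqF.
  rewrite subr_le0 (le_trans (_ : _ <= 0)) ?subr_le0//.
  rewrite mulr_ge0//; last by rewrite mulr_ge0 ?powR_ge0 ?exprn_ge0 ?(ltW x0).
  by rewrite subr_ge0 ler_pdivrMr//; move: p_crit; rewrite ler_pdivrMr//; lra.
by lra.
Qed.

Lemma pohozaev_nincr a b : 0 <= a -> a <= b -> b < r -> pohozaev b <= pohozaev a.
Proof.
move=> a0 ab br; have := @pohozaev_drop a b 0 a0 ab br.
rewrite mul0r subr0; apply => s /andP[as_ _].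
by rewrite mulr_ge0 ?sqr_ge0// exprn_ge0// (le_trans a0)// ltW.
Qed.

Lemma pohozaev_le0 s : 0 <= s < r -> pohozaev s <= 0.
Proof.
move=> /andP[s0 sr]; have := pohozaev_nincr (lexx 0) s0 sr.
by rewrite {2}/pohozaev exprS !mul0r.
Qed.

(** Completing the square in s w' turns the sign of [pohozaev] into a simultaneous control of s w'
    and of s^2 |w|^p by w^2. *)
Lemma pohozaevE s : 2 * s * pohozaev s = s ^+ k.+1 *
  ((s * w1 s + k%:R / 2 * w s) ^+ 2 + 2 / p * s ^+ 2 * `|w s| `^ p
   - (k%:R ^+ 2 / 4 + s ^+ 2) * w s ^+ 2).
Proof. by rewrite /pohozaev /energy; field; rewrite gt_eqF. Qed.

Lemma pohozaev_bound s : 0 < s < r ->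
  (s * w1 s + k%:R / 2 * w s) ^+ 2 + 2 / p * s ^+ 2 * `|w s| `^ p
  <= (k%:R ^+ 2 / 4 + r ^+ 2) * w s ^+ 2.
Proof.
move=> /andP[s0 sr]; have := @pohozaev_le0 s; rewrite (ltW s0) sr => /(_ isT) P0.
have := pohozaevE s; set D := _ - _ => PE.
have : D <= 0.
  by rewrite -(pmulr_rle0 _ (exprn_gt0 k.+1 s0)) -PE pmulr_rle0// mulr_gt0.
rewrite subr_le0 => /le_trans; apply; rewrite ler_wpM2r ?sqr_ge0// lerD2l.
by rewrite ler_sqr ?nnegrE ?(ltW s0) ?(ltW sr)// ltW// (lt_trans s0).
Qed.

Lemma log_derivative_bound s : 0 < s < r -> `|s * w1 s| <= (k%:R + r) * `|w s|.
Proof.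
move=> sr; have /andP[s0 s_r] := sr; have r0 := lt_trans s0 s_r.
have := pohozaev_bound sr.
have : 0 <= 2 / p * s ^+ 2 * `|w s| `^ p.
  by rewrite mulr_ge0 ?powR_ge0// mulr_ge0 ?sqr_ge0// divr_ge0// ltW.
set W := `|w s|; set F := 2 / p * _ * _ => F0 h.
(* k^2/4 + r^2 is at most (k/2 + r)^2; removing the summand k/2 w afterwards costs another k/2,
   whence k + r. *)
have : (s * w1 s + k%:R / 2 * w s) ^+ 2 <= ((k%:R / 2 + r) * W) ^+ 2.
  apply: le_trans (_ : _ <= (k%:R ^+ 2 / 4 + r ^+ 2) * w s ^+ 2) _; first by lra.
  rewrite -[w s ^+ 2]real_normK ?num_real// exprMn ler_wpM2r ?sqr_ge0//.
  by have := mulr_gt0 k0 r0; lra.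
rewrite -[leLHS]real_normK ?num_real// ler_sqr ?nnegrE ?mulr_ge0 ?addr_ge0 ?divr_ge0 ?(ltW r0) ?normr_ge0//.
have := ler_normB (s * w1 s + k%:R / 2 * w s) (k%:R / 2 * w s).
rewrite addrK (_ : `|k%:R / 2 * w s| = k%:R / 2 * W); first by lra.
by rewrite normrM ger0_norm ?divr_ge0.
Qed.

Lemma scaled_bound s : 0 < s < r -> w s != 0 ->
  s ^+ 2 * `|w s| `^ (p - 2) <= p / 2 * (k%:R ^+ 2 / 4 + r ^+ 2).
Proof.
move=> sr w0; have := pohozaev_bound sr.
have := sqr_ge0 (s * w1 s + k%:R / 2 * w s); set Q := _ ^+ 2 => Q0.
rewrite abs_powR_split// => h.
have w20 : 0 < w s ^+ 2 by rewrite lt0r sqrf_eq0 w0 sqr_ge0.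
have h2p : 0 < 2 / p by rewrite divr_gt0.
rewrite -(ler_pM2l h2p) [leRHS](_ : _ = k%:R ^+ 2 / 4 + r ^+ 2); last by field; rewrite gt_eqF.
by rewrite -(ler_pM2r w20); lra.
Qed.

(** With K = k + r, the bound on the logarithmic derivative makes w^2 s^(-2K) nonincreasing. Squares
    avoid any discussion of the sign or the zeros of w. *)
Lemma harnack a b : 0 < a -> a <= b -> b <= 2 * a -> b < r ->
  w b ^+ 2 <= 2 `^ (2 * (k%:R + r)) * w a ^+ 2.
Proof.
move=> a0 ab b2a br; set K := k%:R + r; have b0 := lt_le_trans a0 ab.
have : w b ^+ 2 * b `^ (- (2 * K)) <= w a ^+ 2 * a `^ (- (2 * K)).
  apply: (@ler0_is_derive_le _ (fun s => w s ^+ 2 * s `^ (- (2 * K))) (fun s =>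
     w s ^+ 2 * (- (2 * K) * s `^ (- (2 * K)) / s)
     + s `^ (- (2 * K)) * (2 * w s ^+ 1 * w1 s))) => //.
    move=> x /andP[ax xb]; have x0 := lt_le_trans a0 ax.
    have d1 := rs_der1 sol (_ : 0 <= x < r); rewrite (ltW x0) (le_lt_trans xb)// in d1.
    exact: is_derive_mul (is_derive_exp 2 (d1 isT)) (is_derive_powR_ident _ x0).
  move=> x /andP[ax xb]; have x0 := lt_trans a0 ax.
  rewrite [leLHS](_ : _ = 2 * x `^ (- (2 * K)) / x * (w x * (x * w1 x) - K * w x ^+ 2)); last first.
    by field; rewrite gt_eqF.
  rewrite pmulr_rle0 ?divr_gt0 ?mulr_gt0 ?powR_gt0// subr_le0.
  rewrite (le_trans (ler_norm _))// normrM -[w x ^+ 2]real_normK ?num_real//.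
  rewrite expr2 mulrA mulrC ler_wpM2r// log_derivative_bound//.
  by rewrite x0 (lt_trans xb).
have h2 : b `^ (2 * K) <= 2 `^ (2 * K) * a `^ (2 * K).
  have K0 : 0 <= 2 * K by rewrite mulr_ge0// addr_ge0 ?(ltW k0)// ltW// (lt_trans b0).
  by rewrite -powRM ?(ltW a0)// ge0_ler_powR ?nnegrE ?(ltW b0)// mulr_ge0 ?(ltW a0).
rewrite !powRN ler_pdivrMr ?powR_gt0// => /le_trans; apply.
rewrite mulrAC ler_pdivrMr ?powR_gt0//.
by rewrite [leLHS]mulrC [leRHS]mulrAC ler_wpM2r ?sqr_ge0.
Qed.

End pohozaev.

(** * Decay in the absence of bubbles *)

Section decay.
Context {R : realType} {k : nat} {r p : R}.
Hypothesis k_ge5 : (5 <= k)%N.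
Hypothesis p_crit : 2 * (k%:R + 2) / k%:R <= p.

Let k_gt0 : (0 < k)%N. Proof. exact: leq_trans k_ge5. Qed.
Let k5 : 5 <= k%:R :> R. Proof. by rewrite (ler_nat R 5 k). Qed.

Lemma radial_solutionN (w w1 w2 : R -> R) : radial_solution k r p w w1 w2 ->
  radial_solution k r p (fun s => - w s) (fun s => - w1 s) (fun s => - w2 s).
Proof.
move=> [d1 d2 d0 ode]; split.
- by move=> s /d1; exact: is_derive_opp.
- by move=> s /d2; exact: is_derive_opp.
- by rewrite d0 oppr0.
- by move=> s /ode h; rewrite normrN mulrN h; ring.
Qed.

Lemma nonvanishing_sign (f : R -> R) a b : a <= b ->
  (forall s, a <= s <= b -> {for s, continuous f}) ->
  (forall s, a <= s <= b -> f s != 0) ->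
  (forall s, a <= s <= b -> 0 < f s) \/ (forall s, a <= s <= b -> f s < 0).
Proof.
move=> ab cf f0.
have cst s : a <= s <= b -> ~~ (Num.min (f a) (f s) <= 0 <= Num.max (f a) (f s)).
  move=> /andP[a_s sb]; apply/negP => h.
  have cw : {within `[a, s], continuous f}.
    apply: continuous_in_subspaceT => x; rewrite inE/= in_itv/= => /andP[ax xs].
    by apply: cf; rewrite ax (le_trans xs).
  have [c + fc] := IVT a_s cw h.
  rewrite in_itv/= => /andP[ac cs].
  by have := f0 c; rewrite ac (le_trans cs)// fc eqxx => /(_ isT).
have [fa|fa] := ltP 0 (f a); [left|right] => s sab; have := cst _ sab.
  by rewrite ge_min le_max (ltW fa)/= andbT leNgt fa/= -ltNge.
have fa0 : f a < 0 by rewrite lt_neqAle fa f0// lexx.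
by rewrite ge_min le_max fa/= (leNgt 0 (f a)) fa0/= -ltNge.
Qed.

Section positive.
Context {w w1 w2 : R -> R}.
Hypothesis sol : radial_solution k r p w w1 w2.

(* With t = ln s the equation reads w_tt + k w_t = (s^2 - s^2 |w|^(p-2)) w; the
   operator d_tt + k d_t + A B factors as (d_t + A) (d_t + B) when A + B = k. *)
Lemma factor_ndecr (A B eta a b : R) : A + B = k%:R -> eta <= A * B ->
  0 < a -> a <= b -> b < r ->
  (forall s, a <= s <= b -> 0 <= w s) ->
  (forall s, a < s < b -> s ^+ 2 * `|w s| `^ (p - 2) <= eta) ->
  a `^ A * (a * w1 a + B * w a) <= b `^ A * (b * w1 b + B * w b).
Proof.
move=> AB etaAB a0 ab br wge0 small.
apply: (@ger0_is_derive_le _ (fun s => s `^ A * (s * w1 s + B * w s))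
  (fun s => s `^ A * (s * w2 s + w1 s * 1 + B * w1 s)
            + (s * w1 s + B * w s) * (A * s `^ A / s))) => //.
  move=> s /andP[as_ sb]; have s0 := lt_le_trans a0 as_.
  have sr : 0 <= s < r by rewrite (ltW s0) (le_lt_trans sb).
  have d1 := rs_der1 sol sr; have d2 := rs_der2 sol sr.
  have dp := is_derive_powR_ident A s0; derive.
move=> s sab; have /andP[as_ sb] := sab; have s0 := lt_trans a0 as_.
have sr : 0 < s < r by rewrite s0 (lt_trans sb).
rewrite /= [leRHS](_ : _ = s `^ A / s * (s * (s * w2 s + (k%:R + 1) * w1 s) + A * B * w s)); last first.
  by rewrite -AB; field; rewrite gt_eqF.
rewrite mulr_ge0 ?divr_ge0 ?powR_ge0 ?(ltW s0)// (rs_ode sol sr).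
rewrite [leRHS](_ : _ = (s ^+ 2 + (A * B - s ^+ 2 * `|w s| `^ (p - 2))) * w s); last by ring.
rewrite mulr_ge0 ?wge0 ?(ltW as_) ?(ltW sb)// addr_ge0 ?sqr_ge0// subr_ge0.
exact: le_trans (small _ sab) etaAB.
Qed.

(** [factor_ndecr] is used with both orders of the factors. The pair (e, k - e) on [t, b] bounds t
    w' + (k - e) w from above by data at b; the pair (k - e, e) on [a, t] bounds t w' + e w from
    below by data at a. Subtracting eliminates w' and leaves (k - 2e) w(t), where k - 2e >= 1. The
    derivatives at a and b are removed by [log_derivative_bound]. *)
Lemma gap_bound_pos (e eta a b t : R) : 0 <= e -> 2 * e + 1 <= k%:R ->
  eta <= (k%:R - e) * e -> 0 < a -> a <= t -> t <= b -> b < r ->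
  (forall s, a <= s <= b -> 0 < w s) ->
  (forall s, a <= s < b -> s ^+ 2 * `|w s| `^ (p - 2) <= eta) ->
  w t <= (b / t) `^ e * ((2 * k%:R + r) * w b)
       + (a / t) `^ (k%:R - e) * ((k%:R + r) * w a).
Proof.
move=> e0 ek etae a0 at_ tb br wpos small.
have t0 := lt_le_trans a0 at_; have b0 := lt_le_trans t0 tb.
have r0 := lt_trans b0 br.
have wb : 0 < w b by rewrite wpos// lexx (le_trans at_).
have wa : 0 < w a by rewrite wpos// lexx (le_trans at_).
have wt : 0 < w t by rewrite wpos// at_.
have hY : t `^ e * (t * w1 t + (k%:R - e) * w t) <= b `^ e * (b * w1 b + (k%:R - e) * w b).
  apply: (@factor_ndecr e (k%:R - e) eta) => //; first by ring.
  - by rewrite mulrC.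
  - by move=> s /andP[ts sb]; rewrite ltW// wpos// sb (le_trans at_).
  - by move=> s /andP[ts sb]; rewrite small// sb (le_trans at_)// ltW.
have hX : a `^ (k%:R - e) * (a * w1 a + e * w a) <= t `^ (k%:R - e) * (t * w1 t + e * w t).
  apply: (@factor_ndecr (k%:R - e) e eta) => //; first by ring.
  - exact: le_lt_trans br.
  - by move=> s /andP[as_ st]; rewrite ltW// wpos// as_ (le_trans st).
  - by move=> s /andP[as_ st]; rewrite small// (ltW as_) (lt_le_trans st).
have lb : b * w1 b <= (k%:R + r) * w b.
  have := log_derivative_bound k_gt0 p_crit sol (_ : 0 < b < r); rewrite b0 br => /(_ isT).
  by rewrite (gtr0_norm wb); apply: le_trans; exact: ler_norm.
have la : - ((k%:R + r) * w a) <= a * w1 a.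
  have := log_derivative_bound k_gt0 p_crit sol (_ : 0 < a < r).
  rewrite a0 (le_lt_trans (le_trans at_ tb) br) => /(_ isT).
  by rewrite (gtr0_norm wa) ler_norml => /andP[].
rewrite !powRM ?invr_ge0 ?(ltW a0) ?(ltW t0) ?(ltW b0)//.
rewrite -!powR_inv1 ?(ltW t0)// -!powRrM !mulN1r !powRN.
have te : 0 < t `^ e by exact: powR_gt0.
have tA : 0 < t `^ (k%:R - e) by exact: powR_gt0.
have {}hY : t * w1 t + (k%:R - e) * w t <= b `^ e / t `^ e * ((2 * k%:R + r) * w b).
  rewrite -(ler_pM2l te); apply: le_trans hY _.
  rewrite [leRHS](_ : _ = b `^ e * ((2 * k%:R + r) * w b)); last by field; rewrite gt_eqF.
  by rewrite ler_wpM2l ?powR_ge0//; have := mulr_ge0 e0 (ltW wb); lra.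
have {}hX : - (a `^ (k%:R - e) / t `^ (k%:R - e) * ((k%:R + r) * w a)) <= t * w1 t + e * w t.
  rewrite -(ler_pM2l tA); apply: le_trans hX.
  rewrite [leLHS](_ : _ = a `^ (k%:R - e) * (- ((k%:R + r) * w a))); last by field; rewrite gt_eqF.
  by rewrite ler_wpM2l ?powR_ge0//; have := mulr_ge0 e0 (ltW wa); lra.
have : w t <= (k%:R - 2 * e) * w t by rewrite ler_peMl ?(ltW wt)//; lra.
by lra.
Qed.

End positive.

Lemma gap_bound (w w1 w2 : R -> R) (e eta a b t : R) : radial_solution k r p w w1 w2 ->
  0 <= e -> 2 * e + 1 <= k%:R ->
  eta <= (k%:R - e) * e -> 0 < a -> a <= t -> t <= b -> b < r ->
  (forall s, a <= s <= b -> w s != 0) ->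
  (forall s, a <= s < b -> s ^+ 2 * `|w s| `^ (p - 2) <= eta) ->
  `|w t| <= (b / t) `^ e * ((2 * k%:R + r) * `|w b|)
       + (a / t) `^ (k%:R - e) * ((k%:R + r) * `|w a|).
Proof.
move=> sol e0 ek etae a0 at_ tb br w0 small.
have ab := le_trans at_ tb.
have cw s : a <= s <= b -> {for s, continuous w}.
  move=> /andP[as_ sb]; apply: is_derive_continuous (rs_der1 sol _).
  by rewrite (ltW (lt_le_trans a0 as_)) (le_lt_trans sb).
have aab : a <= a <= b by rewrite lexx.
have bab : a <= b <= b by rewrite lexx andbT.
have tab : a <= t <= b by rewrite at_.
have [wpos|wneg] := nonvanishing_sign ab cw w0.
  by rewrite !gtr0_norm ?wpos//; exact: (gap_bound_pos sol e0 ek etae).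
rewrite !ltr0_norm ?wneg//.
apply: (gap_bound_pos (radial_solutionN sol) e0 ek etae) => //.
- by move=> s /wneg; rewrite oppr_gt0.
- by move=> s /small; rewrite normrN.
Qed.

End decay.

(** * A bubble at a small radius forces another one further out *)

Section bubbles.
Context {R : realType} (k : nat) (r : R).
Hypothesis k_ge5 : (5 <= k)%N.

Let k_gt0 : (0 < k)%N. Proof. exact: leq_trans k_ge5. Qed.
Let k0 : 0 < k%:R :> R. Proof. by rewrite ltr0n. Qed.
Let k5 : 5 <= k%:R :> R. Proof. by rewrite (ler_nat R 5 k). Qed.

(* At the critical exponent (k + 25/6) (p - 2) equals 4 + 50 / (3 k), which is below
   15/2 exactly when k >= 5; here 25/6 = 4 + 2 e for the loss e = 1/12 used below. *)
Definition nearly_critical (p : R) : Prop :=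
  2 * (k%:R + 2) / k%:R <= p /\ (k%:R + 25 / 6) * (p - 2) <= 15 / 2.

(** s^2 |w|^(p-2) is invariant under the scaling of -Delta u = |u|^(p-2) u. The threshold 1/32 = 1/8
    * 1/4 is what [amplitude_bubble] produces, and it is small enough for the decay estimates: it is
    below (k - e) e for e = 1/12. *)
Definition bubble (p : R) (w : R -> R) (s : R) : Prop :=
  32^-1 <= s ^+ 2 * `|w s| `^ (p - 2).

Lemma nearly_criticalP p : nearly_critical p -> 4 / k%:R <= p - 2 <= 1.
Proof.
move=> [h1 h2].
have {}h1 : 2 * (k%:R + 2) <= p * k%:R by rewrite -ler_pdivrMr.
apply/andP; split; first by rewrite ler_pdivrMr// mulrBl; lra.
have [//|p1] := leP (p - 2) 1.
have : 9 * (p - 2) <= 15 / 2.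
  by apply: le_trans h2; rewrite ler_wpM2r//; have := k5; lra.
lra.
Qed.

Lemma powR_small (a c : R) : 0 < a -> 0 < c ->
  exists2 t0 : R, 0 < t0 & forall t, 0 < t -> t <= t0 -> t `^ a <= c.
Proof.
move=> a0 c0; exists (c `^ a^-1) => [|t t0 tc]; first exact: powR_gt0.
rewrite [leRHS](_ : c = (c `^ a^-1) `^ a); last first.
  by rewrite -powRrM mulVf ?gt_eqF// powRr1// ltW.
by rewrite ge0_ler_powR ?nnegrE ?powR_ge0// ltW.
Qed.

(** By Harnack w^2 >= w(s)^2 / H on [s/2, s], so [pohozaev], nonpositive at s/2, loses a definite
    amount there. It never regains it, and by [pohozaevE] its negative part at t is controlled by
    w(t)^2. In particular w has no zero to the right of a point where it is nonzero. *)
Lemma pohozaev_lower p (w w1 w2 : R -> R) s t :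
  2 * (k%:R + 2) / k%:R <= p -> radial_solution k r p w w1 w2 ->
  0 < s -> s <= t -> t < r ->
  2 * ((s / 2) ^+ k.+2 * (w s ^+ 2 / 2 `^ (2 * (k%:R + r))))
  <= t ^+ k * (k%:R ^+ 2 / 4 + r ^+ 2) * w t ^+ 2.
Proof.
move=> pc sol s0 st tr; have t0 := lt_le_trans s0 st.
have r0 := lt_trans t0 tr; have sr := le_lt_trans st tr.
set H := 2 `^ _; have H0 : 0 < H by exact: powR_gt0.
have s20 : 0 < s / 2 by lra.
have s2s : s / 2 <= s by lra.
have drop := @pohozaev_drop _ _ _ _ _ _ _ k_gt0 pc sol (s / 2) s
  ((s / 2) ^+ k.+1 * (w s ^+ 2 / H)) (ltW s20) s2s sr _.
have {drop} : pohozaev k p w w1 s <= pohozaev k p w w1 (s / 2)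
    - (s / 2) ^+ k.+1 * (w s ^+ 2 / H) * (s - s / 2).
  apply: drop => x /andP[sx xs]; apply: ler_pM.
  - by rewrite exprn_ge0// ltW.
  - by rewrite divr_ge0 ?sqr_ge0 ?(ltW H0).
  - by rewrite lerXn2r ?nnegrE ?(ltW s20) ?(ltW sx)// ltW// (lt_trans s20).
  - rewrite ler_pdivrMr// mulrC.
    apply: (harnack k_gt0 pc sol) => //; [exact: lt_trans sx|exact: ltW|lra].
have := pohozaev_le0 k_gt0 pc sol (_ : 0 <= s / 2 < r).
rewrite (ltW s20) (le_lt_trans s2s)// => /(_ isT) P0.
have := pohozaev_nincr k_gt0 pc sol (ltW s0) st tr => P1 P2.
have {P0 P1 P2} P : pohozaev k p w w1 t <= - ((s / 2) ^+ k.+2 * (w s ^+ 2 / H)).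
  by rewrite exprS; lra.
have p2 := gt2_supercritical k_gt0 pc.
have PE := pohozaevE w w1 k_gt0 pc t.
rewrite -(ler_pM2l t0).
apply: (@le_trans _ _ (- (2 * t * pohozaev k p w w1 t))).
  by have := ler_wpM2l (ltW t0) P; lra.
rewrite PE -mulrN exprS -!mulrA ler_pM2l// ler_wpM2l ?exprn_ge0 ?(ltW t0)//.
have : 0 <= 2 / p * (t ^+ 2 * `|w t| `^ p).
  by rewrite mulr_ge0 ?divr_ge0 ?mulr_ge0 ?powR_ge0 ?sqr_ge0//; lra.
have := sqr_ge0 (t * w1 t + k%:R / 2 * w t).
have : (k%:R ^+ 2 / 4 + t ^+ 2) * w t ^+ 2 <= (k%:R ^+ 2 / 4 + r ^+ 2) * w t ^+ 2.
  by rewrite ler_wpM2r ?sqr_ge0// lerD2l ler_sqr ?nnegrE ?(ltW t0) ?(ltW r0)// ltW.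
lra.
Qed.

(** Inverts x^a with a bound independent of a, hence of p. The requirement 1 <= B settles x <= 1;
    for x > 1 the exponent may be lowered to 4/k. *)
Lemma powR_root_le (a x B : R) : 4 / k%:R <= a -> 0 <= x -> 1 <= B ->
  x `^ a <= B -> x <= B `^ (k%:R / 4).
Proof.
move=> ka x0 B1 xB; have B0 : 0 <= B := le_trans ler01 B1.
have k4 : 0 <= k%:R / 4 :> R by rewrite divr_ge0.
have [x1|x1] := leP x 1.
  by apply: le_trans x1 _; rewrite -[leLHS](powRr0 B) ler_powR.
rewrite [leLHS](_ : _ = (x `^ (4 / k%:R)) `^ (k%:R / 4)); last first.
  rewrite -powRrM (_ : 4 / k%:R * (k%:R / 4) = 1) ?powRr1//.
  by field; rewrite gt_eqF.
rewrite ge0_ler_powR ?nnegrE ?powR_ge0//.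
by apply: le_trans xB; rewrite ler_powR// ltW.
Qed.

Lemma far_bound d : 0 < d < r -> exists2 D, 0 <= D &
  forall p (w w1 w2 : R -> R), nearly_critical p ->
    radial_solution k r p w w1 w2 -> `|w d| <= D.
Proof.
move=> dr; have /andP[d0 _] := dr.
(* The factor 3/2 bounds the p/2 of [scaled_bound], as p <= 3. *)
pose B := Num.max 1 (3 / 2 * (k%:R ^+ 2 / 4 + r ^+ 2) / d ^+ 2).
have B1 : 1 <= B by rewrite le_max lexx.
exists (B `^ (k%:R / 4)) => [|p w w1 w2 pc sol]; first exact: powR_ge0.
have /andP[p4 p1] := nearly_criticalP pc.
have [->|w0] := eqVneq (w d) 0; first by rewrite normr0 powR_ge0.
apply: (powR_root_le p4) => //.
rewrite le_max; apply/orP; right; rewrite ler_pdivlMr ?exprn_gt0// mulrC.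
apply: le_trans (scaled_bound k_gt0 (proj1 pc) sol dr w0) _.
rewrite ler_wpM2r ?addr_ge0 ?divr_ge0 ?sqr_ge0//; lra.
Qed.

(* Any small enough loss e > 0 in the decay rates would do. *)
Local Notation e := (12^-1 : R).
Local Notation H := (2 `^ (2 * (k%:R + r)) : R).

(** [pohozaev_lower] at s = t^2, where s^(k+2) / t^k = t^(k+4). *)
Lemma pohozaev_lower_sqrt p (w w1 w2 : R -> R) t :
  2 * (k%:R + 2) / k%:R <= p -> radial_solution k r p w w1 w2 ->
  0 < t -> t <= 1 -> t < r ->
  2 / (2 ^+ k.+2 * H * (k%:R ^+ 2 / 4 + r ^+ 2)) * t `^ (k%:R + 4) * w (t ^+ 2) ^+ 2
  <= w t ^+ 2.
Proof.
move=> pc sol t0 t1 tr; have tt : t ^+ 2 <= t by rewrite expr2 ger_pMr.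
have r0 := lt_trans t0 tr.
have := pohozaev_lower pc sol (exprn_gt0 2 t0) tt tr.
have tk4 : t `^ (k%:R + 4) = t ^+ k.+4.
  by rewrite -powR_mulrn ?(ltW t0)// -natrD addn4.
have m0 : 0 < k%:R ^+ 2 / 4 + r ^+ 2.
  by rewrite ltr_wpDl ?exprn_gt0// divr_ge0 ?sqr_ge0.
have H0 : 0 < H by exact: powR_gt0.
move: (H) (k%:R ^+ 2 / 4 + r ^+ 2) H0 m0 => h m h0 m0 low.
rewrite tk4 -(ler_pM2l (_ : 0 < t ^+ k * m)); last by rewrite mulr_gt0 ?exprn_gt0.
apply: le_trans low; rewrite le_eqVlt; apply/orP; left; apply/eqP.
have tE : (t ^+ 2) ^+ k.+2 = t ^+ k * t ^+ k.+4.
  by rewrite -(exprM t 2 k.+2) -(exprD t k k.+4) mul2n -addnn !addnS addSn.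
have n0 : 2 ^+ k.+2 != 0 :> R by rewrite expf_neq0// pnatr_eq0.
rewrite expr_div_n tE; move: (2 ^+ k.+2) (t ^+ k) (t ^+ k.+4) n0 => x2 x3 x4 n0.
by field; rewrite n0 !gt_eqF.
Qed.

Lemma powR_mul2 (t a : R) : t `^ (2 * a) = (t `^ a) ^+ 2.
Proof. by rewrite mulrC powRrM powR_mulrn ?powR_ge0. Qed.

(** The square of [gap_bound] on [2 t^2, d]. The gap starts at twice the bubble radius t^2 because
    the next bubble is sought only from there on; Harnack brings w(2 t^2) back to w(t^2). *)
Lemma gap_upper_sqrt p (w w1 w2 : R -> R) d D t : nearly_critical p ->
  radial_solution k r p w w1 w2 -> 0 < t -> t <= 1 / 2 -> t <= d -> d < r ->
  (forall x, 2 * t ^+ 2 <= x <= d -> w x != 0) ->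
  (forall x, 2 * t ^+ 2 <= x < d -> ~ bubble p w x) -> `|w d| <= D ->
  w t ^+ 2 <= 2 * (d `^ e * ((2 * k%:R + r) * D)) ^+ 2 * t `^ (- (2 * e))
    + 2 * (2 `^ (k%:R - e) * (k%:R + r)) ^+ 2 * H * t `^ (2 * (k%:R - e))
      * w (t ^+ 2) ^+ 2.
Proof.
move=> pc sol t0 th td dr wn0 nobubble wD; have kge5 := k5.
have d0 := lt_le_trans t0 td; have r0 := lt_trans d0 dr.
have t20 : 0 < t ^+ 2 by exact: exprn_gt0.
have st : 2 * t ^+ 2 <= t.
  by rewrite expr2 mulrA ger_pMl//; lra.
have small x : 2 * t ^+ 2 <= x < d -> x ^+ 2 * `|w x| `^ (p - 2) <= 32^-1.
  by move=> /nobubble/negP; rewrite -ltNge => /ltW.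
have e_ge0 : 0 <= e by rewrite invr_ge0.
have e_k : 2 * e + 1 <= k%:R by lra.
have eta_e : 32^-1 <= (k%:R - e) * e by lra.
have s0 : 0 < 2 * t ^+ 2 by lra.
have := gap_bound k_ge5 (proj1 pc) sol e_ge0 e_k eta_e s0 st td dr wn0 small.
have h2 : w (2 * t ^+ 2) ^+ 2 <= H * w (t ^+ 2) ^+ 2.
  by apply: (harnack k_gt0 (proj1 pc) sol t20); lra.
rewrite (_ : 2 * t ^+ 2 / t = 2 * t); last by field; rewrite gt_eqF.
have tV : t^-1 `^ e = t `^ (- e) by rewrite -(powR_inv1 (ltW t0)) -powRrM mulN1r.
rewrite (powRM _ (ltW d0)) ?invr_ge0 ?(ltW t0)// tV (powRM _ (ler0n _ 2) (ltW t0)).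
rewrite -mulrN !(powR_mul2 t).
have kr : 0 <= 2 * k%:R + r by lra.
have kr' : 0 <= k%:R + r by lra.
have := powR_ge0 t (- e); have := powR_ge0 t (k%:R - e); have := powR_ge0 d e.
have := powR_ge0 2 (k%:R - e).
move: (t `^ (- e)) (t `^ (k%:R - e)) (d `^ e) (2 `^ (k%:R - e)) (H) h2.
move=> X Y X' Y' h h2 Y'0 X'0 Y0 X0.
move: (2 * k%:R + r) (k%:R + r) kr kr' => A B A0 B0 gap.
pose U := X' * X * (A * D); pose V := Y' * Y * (B * `|w (2 * t ^+ 2)|).
have gapUV : `|w t| <= U + V.
  by apply: le_trans gap _; rewrite lerD2r ler_wpM2l ?mulr_ge0// ler_wpM2l.
have : w t ^+ 2 <= 2 * U ^+ 2 + 2 * V ^+ 2.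
  apply: (@le_trans _ _ ((U + V) ^+ 2)).
    rewrite -[w t ^+ 2]real_normK ?num_real// ler_sqr ?nnegrE//.
    exact: le_trans gapUV.
  rewrite -subr_ge0 (_ : _ - _ = (U - V) ^+ 2) ?sqr_ge0//; ring.
move/le_trans; apply; apply: lerD.
  by rewrite /U le_eqVlt; apply/orP; left; apply/eqP; ring.
have -> : 2 * V ^+ 2 = 2 * (Y' * B) ^+ 2 * Y ^+ 2 * w (2 * t ^+ 2) ^+ 2.
  by rewrite /V -[w (2 * t ^+ 2) ^+ 2]real_normK ?num_real//; ring.
rewrite [leRHS](_ : _ = 2 * (Y' * B) ^+ 2 * Y ^+ 2 * (h * w (t ^+ 2) ^+ 2)); last by ring.
by rewrite ler_wpM2l// mulr_ge0 ?sqr_ge0// mulr_ge0 ?sqr_ge0.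
Qed.

(* The two bounds are incompatible at small t because k - 4 - 2 e > 0 and
   4 - (k + 4 + 2 e) (p - 2) / 2 >= 1/4 for nearly critical p. *)
Lemma bubble_absorb (c D Q t W y sigma : R) : 0 < c -> 0 < t -> t <= 1 ->
  0 <= D -> Q * t `^ (k%:R - 4 - 2 * e) <= c / 2 ->
  c * t `^ (k%:R + 4) * W ^+ 2 <= y ->
  y <= D * t `^ (- (2 * e)) + Q * t `^ (2 * (k%:R - e)) * W ^+ 2 ->
  0 < sigma <= 1 -> (k%:R + 25 / 6) * sigma <= 15 / 2 ->
  32^-1 <= (t ^+ 2) ^+ 2 * `|W| `^ sigma ->
  32^-1 <= Num.max 1 (2 * D / c) * t `^ 4^-1.
Proof.
move=> c0 t0 t1 D0 Qc low up /andP[s0 s1] ks bub; set C := Num.max _ _.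
have tn0 : t == 0 = false by rewrite gt_eqF.
have C1 : 1 <= C by rewrite le_max lexx.
have C0 : 0 <= C := le_trans ler01 C1.
set q := k%:R + 4 + 2 * e.
(* The hypothesis on [Q] makes the W^2 term of the upper bound at most half of the lower bound.
   Absorbing it leaves only the term in [D]. *)
have key : t `^ q * W ^+ 2 <= C.
  rewrite le_max; apply/orP; right; rewrite ler_pdivlMr//.
  have T0 : 0 < t `^ (2 * e) by exact: powR_gt0.
  have T40 : 0 <= t `^ (k%:R + 4) by exact: powR_ge0.
  have h : Q * t `^ (2 * (k%:R - e)) <= c / 2 * t `^ (k%:R + 4).
    rewrite (_ : 2 * (k%:R - e) = (k%:R - 4 - 2 * e) + (k%:R + 4)); last by ring.
    by rewrite powRD ?tn0 ?implybT// mulrA ler_wpM2r.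
  have {}h := ler_wpM2r (sqr_ge0 W) h.
  have {}low := le_trans low up.
  have {}h : c / 2 * t `^ (k%:R + 4) * W ^+ 2 <= D * t `^ (- (2 * e)) by lra.
  have := ler_wpM2l (ltW T0) h; rewrite powRN [leRHS](_ : _ = D); last first.
    by field; rewrite gt_eqF.
  by move=> h2; rewrite /q powRD ?tn0 ?implybT//; lra.
have WE : `|W| `^ sigma = (W ^+ 2) `^ (sigma / 2).
  rewrite -[W ^+ 2]real_normK ?num_real// -powR_mulrn// -powRrM.
  by congr powR; field.
have W2 : W ^+ 2 <= C * t `^ (- q).
  by rewrite powRN ler_pdivlMr ?powR_gt0// mulrC.
have s2 : 0 <= sigma / 2 by rewrite divr_ge0// ltW.
have s21 : sigma / 2 <= 1 by lra.
have hW : (W ^+ 2) `^ (sigma / 2) <= C * t `^ (- q * (sigma / 2)).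
  apply: (@le_trans _ _ ((C * t `^ (- q)) `^ (sigma / 2))).
    by rewrite ge0_ler_powR ?nnegrE ?s2 ?sqr_ge0// mulr_ge0 ?powR_ge0.
  by rewrite powRM ?powR_ge0// -powRrM ler_wpM2r ?powR_ge0// ler1_powR.
apply: le_trans bub _; rewrite WE -(exprM t 2 2) -powR_mulrn ?(ltW t0)//.
apply: (@le_trans _ _ (t `^ 4 * (C * t `^ (- q * (sigma / 2))))).
  by rewrite ler_wpM2l ?powR_ge0.
rewrite mulrCA -powRD ?tn0 ?implybT// ler_wpM2l//.
rewrite ger_powR ?t0//= /q.
have -> : - (k%:R + 4 + 2 * e) * (sigma / 2) = - ((k%:R + 25 / 6) * sigma / 2) by field.
by lra.
Qed.

Lemma bubble_step d : 0 < d < r -> exists2 d', 0 < d' &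
  forall p (w w1 w2 : R -> R), nearly_critical p ->
    radial_solution k r p w w1 w2 ->
  forall s, 0 < s -> s < d' -> bubble p w s ->
    exists2 t, 2 * s <= t < d & bubble p w t.
Proof.
move=> dr; have /andP[d0 d_r] := dr; have r0 := lt_trans d0 d_r.
have [D D0 wdD] := far_bound dr.
pose c : R := 2 / (2 ^+ k.+2 * H * (k%:R ^+ 2 / 4 + r ^+ 2)).
have c0 : 0 < c.
  have m0 : 0 < k%:R ^+ 2 / 4 + r ^+ 2.
    by rewrite ltr_wpDl ?exprn_gt0// divr_ge0 ?sqr_ge0.
  by rewrite divr_gt0// mulr_gt0// mulr_gt0 ?powR_gt0// exprn_gt0.
pose D' : R := 2 * (d `^ e * ((2 * k%:R + r) * D)) ^+ 2.
have D'0 : 0 <= D' by rewrite mulr_ge0 ?sqr_ge0.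
pose Q : R := 2 * (2 `^ (k%:R - e) * (k%:R + r)) ^+ 2 * H.
have Q0 : 0 < Q.
  have kr : 0 < k%:R + r by rewrite ltr_wpDl.
  by rewrite mulr_gt0 ?powR_gt0// mulr_gt0// exprn_gt0// mulr_gt0 ?powR_gt0.
pose C : R := Num.max 1 (2 * D' / c).
have C1 : 0 < C by rewrite lt_max ltr01.
have e_small : 0 < k%:R - 4 - 2 * e by have := k5; lra.
have c2Q : 0 < c / 2 / Q by apply: divr_gt0 => //; apply: divr_gt0.
have [t1 t10 small1] := powR_small e_small c2Q.
have fourth : 0 < 4^-1 :> R by rewrite invr_gt0.
have C0 : 0 < 64^-1 / C by rewrite divr_gt0 ?invr_gt0.
have [t2 t20 small2] := powR_small fourth C0.
(* [t1] allows the absorption, [t2] makes the right-hand side of [bubble_absorb] at most 1/64 <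
   1/32, 1/2 ensures 2 t^2 <= t, and [d] keeps t inside the gap. *)
pose t0 := Num.min (Num.min t1 t2) (Num.min (1 / 2) d).
have t00 : 0 < t0 by rewrite !lt_min t10 t20 d0 andbT/= divr_gt0.
exists (t0 ^+ 2) => [|p w w1 w2 pc sol s s0 sd bs]; first exact: exprn_gt0.
apply: contrapT => nobubble.
pose t := Num.sqrt s.
have tgt0 : 0 < t by rewrite sqrtr_gt0.
have st2 : s = t ^+ 2 by rewrite sqr_sqrtr// ltW.
have : t <= t0.
  by rewrite -(ger0_norm (ltW t00)) -sqrtr_sqr ler_wsqrtr// ltW.
rewrite !le_min -!andbA => /and4P[tt1 tt2 th td].
have tr : t < r := le_lt_trans td d_r.
have th1 : t <= 1 by apply: le_trans th _; rewrite ler_pdivrMr// mul1r ler1n.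
have p2 : 0 < p - 2 by rewrite subr_gt0; exact: gt2_supercritical (proj1 pc).
have ws0 : w s != 0.
  apply: contraPneq bs => ws; rewrite /bubble ws normr0 powR0 ?gt_eqF// mulr0.
  by apply/negP; rewrite -ltNge invr_gt0.
(* A zero of w at x would make the right-hand side of [pohozaev_lower] vanish, hence w(s) as
   well. *)
have wn0 x : 2 * t ^+ 2 <= x <= d -> w x != 0.
  move=> /andP[sx xd]; apply: contra_neqN ws0 => /eqP wx.
  have s_x : s <= x by apply: le_trans sx; rewrite -st2 ler_peMl ?(ltW s0)// ler1n.
  have := pohozaev_lower (proj1 pc) sol s0 s_x (le_lt_trans xd d_r).
  rewrite wx expr0n mulr0 pmulr_rle0// pmulr_rle0 ?exprn_gt0 ?divr_gt0//.
  rewrite pmulr_lle0 ?invr_gt0 ?powR_gt0// => h.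
  by apply/eqP; rewrite -sqrf_eq0 eq_le h sqr_ge0.
have nob x : 2 * t ^+ 2 <= x < d -> ~ bubble p w x.
  by rewrite -st2 => sx bx; apply: nobubble; exists x.
have lower := pohozaev_lower_sqrt (proj1 pc) sol tgt0 th1 tr.
have upper := gap_upper_sqrt pc sol tgt0 th td d_r wn0 nob (wdD _ _ _ _ pc sol).
have Qc : Q * t `^ (k%:R - 4 - 2 * e) <= c / 2.
  by rewrite mulrC -ler_pdivlMr// small1.
have s01 : 0 < p - 2 <= 1 by rewrite p2; have /andP[_ ->] := nearly_criticalP pc.
rewrite /bubble st2 in bs.
have := bubble_absorb c0 tgt0 th1 D'0 Qc lower upper s01 (proj2 pc) bs.
apply/negP; rewrite -ltNge; have := small2 _ tgt0 tt2.
rewrite ler_pdivlMr// mulrC => /le_lt_trans; apply.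
by rewrite ltf_pV2 ?posrE// ltr_nat.
Qed.

End bubbles.

(** * A large value at the origin produces many bubbles *)

Section amplitude.
Context {R : realType} (k : nat) (r : R).
Hypothesis k_ge5 : (5 <= k)%N.

Let k_gt0 : (0 < k)%N. Proof. exact: leq_trans k_ge5. Qed.
Let k0 : 0 < k%:R :> R. Proof. by rewrite ltr0n. Qed.

(** Energy decreases from its value at 0, which is at most |w(0)|^p / p. Where |w|^(p-2) > 3 >= p,
    the term w^2/2 is at most half of |w|^p / p, so |w|^p <= 2 |w(0)|^p. *)
Lemma profile_sup_bound p (w w1 w2 : R -> R) s : nearly_critical k p ->
  radial_solution k r p w w1 w2 -> 0 <= s < r ->
  `|w s| <= Num.max (3 `^ (k%:R / 4)) (2 * `|w 0|).
Proof.
move=> pc sol sr; have /andP[p4 p1] := nearly_criticalP k_ge5 pc.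
have p2 := gt2_supercritical k_gt0 (proj1 pc).
rewrite le_max; have [wp|wp] := leP (`|w s| `^ (p - 2)) 3.
  by rewrite (powR_root_le k_ge5 p4)// ler1n.
apply/orP; right; have := energy_le0 k_gt0 (proj1 pc) sol sr.
rewrite /energy (rs_der1_0 sol) expr0n/= mul0r sub0r => Es.
have p0 : 0 < p by lra.
have wsE := abs_powR_split (w s) p0.
have : `|w s| `^ p <= 2 * `|w 0| `^ p.
  have h1 : 3 * w s ^+ 2 <= `|w s| `^ p.
    by rewrite wsE ler_wpM2r ?sqr_ge0// ltW.
  have h2 : w s ^+ 2 <= `|w s| `^ p / p.
    rewrite ler_pdivlMr//; apply: le_trans h1.
    by rewrite mulrC ler_wpM2r ?sqr_ge0//; lra.
  have h3 : `|w s| `^ p / p <= 2 * (`|w 0| `^ p / p).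
    by have := sqr_ge0 (w1 s); have := sqr_ge0 (w 0); lra.
  by move: h3; rewrite mulrA ler_pM2r ?invr_gt0.
have h2p : 2 <= 2 `^ p :> R by rewrite -[leLHS](@powRr1 _ 2)// ler_powR//; lra.
move=> h; rewrite -(@ler_gt0_powR2r _ p)// ?mulr_ge0// powRM//.
by apply: le_trans h _; rewrite ler_wpM2r ?powR_ge0.
Qed.

(** s^k (s v' + (k+1) v) is the derivative of s^(k+1) v, so the bound integrates from 0. With v = w'
    this controls w'/s up to the singular point s = 0 of the equation. *)
Lemma radial_quotient_bound (v dv : R -> R) (B : R) :
  (forall s, 0 <= s < r -> is_derive s 1 v (dv s)) ->
  (forall s, 0 < s < r -> `|s * dv s + (k%:R + 1) * v s| <= B * s) ->
  forall s, 0 < s < r -> `|v s| <= B * s.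
Proof.
have upper (f df : R -> R) : (forall s, 0 <= s < r -> is_derive s 1 f (df s)) ->
    (forall s, 0 < s < r -> `|s * df s + (k%:R + 1) * f s| <= B * s) ->
    forall s, 0 < s < r -> f s <= B * s.
  move=> fdf fB s /andP[s0 sr].
  rewrite -(ler_pM2l (exprn_gt0 k.+1 s0)) -subr_le0.
  rewrite [leRHS](_ : 0 = 0 ^+ k.+1 * f 0 - 0 ^+ k.+1 * (B * 0)); last by rewrite expr0n/=; ring.
  apply: (@ler0_is_derive_le _ (fun x => x ^+ k.+1 * f x - x ^+ k.+1 * (B * x))
    (fun x => (x ^+ k.+1 * df x + f x * (k.+1%:R * x ^+ k * 1))
     - (x ^+ k.+1 * (B * 1) + B * x * (k.+1%:R * x ^+ k * 1)))); first exact: ltW.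
    move=> x /andP[x0 xs]; have dx := fdf x; rewrite x0 (le_lt_trans xs)// in dx.
    by have {}dx := dx isT; derive.
  move=> x /andP[x0 xs]; have h := fB x; rewrite x0 (lt_trans xs)// in h.
  have {}h := le_trans (ler_norm _) (h isT).
  have Bx : 0 <= B * x by apply: le_trans (fB x _); rewrite ?x0 ?(lt_trans xs).
  rewrite [leLHS](_ : _ = x ^+ k * (x * df x + (k%:R + 1) * f x - B * x - (k%:R + 1) * (B * x))); last first.
    by rewrite -natr1 exprS; ring.
  rewrite pmulr_rle0 ?exprn_gt0//.
  by have := mulr_ge0 (ltW k0) Bx; lra.
move=> vdv vB s sr; rewrite ler_norml; apply/andP; split; last exact: upper vB s sr.
rewrite lerNl; apply: (upper (fun x => - v x) (fun x => - dv x)) sr.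
- by move=> x /vdv; exact: is_derive_opp.
- by move=> x /vB; rewrite -normrN; congr (`|_| <= _); ring.
Qed.

(** With A = 2 |w(0)|, the equation gives |w(s) - w(0)| <= 2 A^(p-1) s^2. Hence w keeps a fixed
    fraction of w(0) up to radii of order A^(-(p-2)/2), which are small when A is large. *)
Lemma amplitude_bubble d : 0 < d -> 0 < r -> exists L,
  forall p (w w1 w2 : R -> R), nearly_critical k p ->
    radial_solution k r p w w1 w2 -> L <= `|w 0| ->
    exists2 s, 0 < s < d & bubble p w s.
Proof.
move=> d0 r0; pose m := Num.min d r.
have m0 : 0 < m by rewrite lt_min d0.
have k4 : 0 < 4 / k%:R :> R by rewrite divr_gt0.
have [t0 t00 small] := powR_small k4 (exprn_gt0 2 m0).
(* The three terms give A >= 2, make 2 |w(0)| the larger term in [profile_sup_bound], and place the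
   bubble below both d and r. *)
exists (Num.max (Num.max 1 (3 `^ (k%:R / 4))) t0^-1) => p w w1 w2 pc sol.
rewrite !ge_max -andbA => /and3P[L1 L3 Lt].
have /andP[p4 p1] := nearly_criticalP k_ge5 pc.
have p2 := gt2_supercritical k_gt0 (proj1 pc).
pose A := 2 * `|w 0|; have A2 : 2 <= A by rewrite /A; lra.
have A0 : 0 < A by lra.
have wA s : 0 <= s < r -> `|w s| <= A.
  move=> sr; apply: le_trans (profile_sup_bound pc sol sr) _.
  by rewrite ge_max lexx andbT /A; lra.
pose B := 2 * A `^ (p - 1).
have B0 : 0 < B by rewrite mulr_gt0 ?powR_gt0.
have AB : A `^ (p - 1) = A `^ (p - 2) * A.
  rewrite (_ : p - 1 = p - 2 + 1); last by ring.
  by rewrite powRD ?powRr1 ?ltW// (gt_eqF A0) implybT.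
have w1B s : 0 < s < r -> `|w1 s| <= B * s.
  apply: radial_quotient_bound (rs_der2 sol) _ s => s sr.
  have /andP[s0 s_r] := sr.
  rewrite (rs_ode sol sr) subrK normrM (gtr0_norm s0) mulrC ler_wpM2r ?(ltW s0)//.
  have ws := wA s; rewrite (ltW s0) s_r in ws; have {}ws := ws isT.
  apply: le_trans (ler_normB _ _) _; rewrite normrM (ger0_norm (powR_ge0 _ _)).
  have h1 : `|w s| `^ (p - 2) * `|w s| <= A `^ (p - 1).
    by rewrite AB ler_pM ?powR_ge0// ge0_ler_powR ?nnegrE ?(ltW A0)//; lra.
  have h2 : `|w s| <= A `^ (p - 1).
    by apply: le_trans ws _; rewrite -[leLHS](powRr1 (ltW A0)) ler_powR//; lra.
  by rewrite /B; lra.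
have wB s : 0 <= s < r -> `|w s - w 0| <= B * s ^+ 2.
  move=> /andP[s0 s_r].
  have dw x : 0 <= x <= s -> is_derive x 1 w (w1 x).
    by move=> /andP[x0 xs]; apply: (rs_der1 sol); rewrite x0 (le_lt_trans xs).
  have w1x x : 0 < x < s -> `|w1 x| <= B * x.
    by move=> /andP[x0 xs]; apply: w1B; rewrite x0 (lt_trans xs).
  have h1 : w s - B * s ^+ 2 <= w 0 - B * 0 ^+ 2.
    apply: (@ler0_is_derive_le _ (fun x => w x - B * x ^+ 2)
      (fun x => w1 x - B * (2 * x ^+ 1 * 1))) => // x xs.
      by have dx := dw _ xs; derive.
    by have := ler_norm (w1 x); have := w1x _ xs; have /andP[x0 _] := xs;
      have := mulr_gt0 B0 x0; lra.
  have h2 : w 0 + B * 0 ^+ 2 <= w s + B * s ^+ 2.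
    apply: (@ger0_is_derive_le _ (fun x => w x + B * x ^+ 2)
      (fun x => w1 x + B * (2 * x ^+ 1 * 1))) => // x xs.
      by have dx := dw _ xs; derive.
    by have := ler_norm (- w1 x); rewrite normrN; have := w1x _ xs; have /andP[x0 _] := xs;
      have := mulr_gt0 B0 x0; lra.
  by rewrite ler_norml; move: h1 h2; rewrite expr0n/= mulr0; lra.
(* This makes B s^2 = A/4. As |w(0)| = A/2, it follows that |w(s)| >= A/4, and s^2 |w(s)|^(p-2) >=
   (1/4)^(p-2) / 8 >= 1/32 since p - 2 <= 1. *)
pose s := Num.sqrt (A `^ (- (p - 2)) / 8).
have s2 : s ^+ 2 = A `^ (- (p - 2)) / 8 by rewrite sqr_sqrtr// divr_ge0 ?powR_ge0.
have s0 : 0 < s by rewrite sqrtr_gt0 divr_gt0 ?powR_gt0.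
have sm : s < m.
  rewrite -(gtr0_norm m0) -sqrtr_sqr ltr_sqrt ?exprn_gt0//.
  apply: (@lt_le_trans _ _ (A `^ (- (p - 2)))).
    by rewrite ltr_pdivrMr// ltr_pMr ?powR_gt0//; lra.
  have Ai0 : 0 < A^-1 by rewrite invr_gt0.
  have -> : A `^ (- (p - 2)) = A^-1 `^ (p - 2).
    by rewrite -[A^-1]powR_inv1 ?ltW// -powRrM mulN1r.
  apply: (@le_trans _ _ (A^-1 `^ (4 / k%:R))).
    by rewrite ger_powR// Ai0 invf_le1//; lra.
  apply: small => //; rewrite -[leRHS]invrK lef_pV2 ?posrE ?invr_gt0//.
  by rewrite /A; lra.
move: sm; rewrite lt_min => /andP[sd sr].
exists s; first by rewrite s0 sd.
have ws : A / 4 <= `|w s|.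
  have := wB s; rewrite (ltW s0) sr => /(_ isT).
  have -> : B * s ^+ 2 = A / 4.
    rewrite s2 /B AB powRN; field; by rewrite gt_eqF ?powR_gt0.
  have := ler_normD (w s) (w 0 - w s); rewrite addrC subrK distrC.
  by rewrite /A; lra.
rewrite /bubble s2.
apply: (@le_trans _ _ (A `^ (- (p - 2)) / 8 * (A / 4) `^ (p - 2))); last first.
  rewrite ler_wpM2l ?divr_ge0 ?powR_ge0// ge0_ler_powR ?nnegrE ?divr_ge0 ?(ltW A0)//; lra.
have -> : (A / 4) `^ (p - 2) = A `^ (p - 2) * 4^-1 `^ (p - 2).
  by rewrite (powRM _ (ltW A0)).
rewrite powRN.
rewrite [leRHS](_ : _ = 4^-1 `^ (p - 2) / 8); last by field; rewrite gt_eqF ?powR_gt0.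
have : 4^-1 <= 4^-1 `^ (p - 2) :> R.
  by rewrite -[leLHS](@powRr1 _ 4^-1) ?invr_ge0// ger_powR// invr_gt0 ltr0n/= invf_le1// ler1n.
lra.
Qed.

(** The thresholds are fixed from the outside inwards: the next bubble must fall below the threshold
    [d1] from which a chain of length J stays below d. This is why [bubble_step] is needed for an
    arbitrary outer radius. *)
Lemma bubble_chain J d : 0 < d < r -> exists2 d', 0 < d' &
  forall p (w w1 w2 : R -> R), nearly_critical k p ->
    radial_solution k r p w w1 w2 ->
  forall s, 0 < s -> s < d' -> bubble p w s ->
  exists f : nat -> R, [/\ f 0%N = s,
    forall j, (j < J)%N -> 2 * f j <= f j.+1 &
    forall j, (j <= J)%N -> 0 < f j < d /\ bubble p w (f j)].
Proof.
elim: J d => [|J IH] d dr.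
  exists d => [|p w w1 w2 pc sol s s0 sd bs]; first by case/andP: dr.
  by exists (fun=> s); split => // j _; rewrite s0.
have /andP[d0 d_r] := dr.
have [d1 d10 chain] := IH _ dr.
pose m := Num.min d1 d.
have mr : 0 < m < r by rewrite lt_min d10 d0 gt_min d_r orbT.
have [d' d'0 step] := bubble_step k_ge5 mr.
exists (Num.min d' m) => [|p w w1 w2 pc sol s s0 + bs].
  by rewrite lt_min d'0; case/andP: mr.
rewrite !lt_min => /and3P[sd' sd1 sd].
have [t /andP[st]] := step _ _ _ _ pc sol _ s0 sd' bs.
rewrite lt_min => /andP[td1 td] bt; have t0 : 0 < t by lra.
have [f [f0 f2 fb]] := chain _ _ _ _ pc sol _ t0 td1 bt.
exists (fun j => if j is i.+1 then f i else s); split => //.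
- by case=> [_|j]; [rewrite f0|rewrite ltnS; exact: f2].
- by case=> [_|j]; [rewrite s0|rewrite ltnS; exact: fb].
Qed.

Lemma many_bubbles J : 0 < r -> exists L,
  forall p (w w1 w2 : R -> R), nearly_critical k p ->
    radial_solution k r p w w1 w2 -> L <= `|w 0| ->
  exists f : nat -> R, (forall j, (j < J)%N -> 2 * f j <= f j.+1) /\
    (forall j, (j <= J)%N -> 0 < f j < r /\ bubble p w (f j)).
Proof.
move=> r0; have r2 : 0 < r / 2 < r by lra.
have [d d0 chain] := bubble_chain J r2.
have [L bL] := amplitude_bubble d0 r0.
exists L => p w w1 w2 pc sol wL.
have [s /andP[s0 sd] bs] := bL _ _ _ _ pc sol wL.
have [f [_ f2 fb]] := chain _ _ _ _ pc sol _ s0 sd bs.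
exists f; split => // j /fb[/andP[f0 fr] bf]; split=> //.
by rewrite f0; lra.
Qed.

End amplitude.

(** * Mass of a bubble *)

Section integral_lower_bound.
Context {R : realType} d (T : measurableType d).
Variable mu : {measure set T -> \bar R}.
Local Open Scope ereal_scope.

(* Unlike [ge0_le_integral], no measurability: the integral of a nonnegative
   function is a supremum over the simple functions below it. *)
Lemma le_ge0_integral (f g : T -> \bar R) : (forall x, 0 <= f x) ->
  (forall x, f x <= g x) -> \int[mu]_x f x <= \int[mu]_x g x.
Proof.
move=> f0 fg; rewrite !ge0_integralTE//; last first.
  by move=> x; exact: le_trans (fg x).
by apply: ereal_sup_le => _ [h hf <-]; exists h => //= x; exact: le_trans (hf x) (fg x).
Qed.

(** f dominates the simple function summing c_i on B_i, because by disjointness at most one term is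
    nonzero at each point. *)
Lemma ge0_integral_disjoint_lower (f : T -> \bar R) (n : nat) (B : 'I_n -> set T)
    (c : 'I_n -> R) (e : R) :
  (forall x, 0 <= f x) -> (forall i, measurable (B i)) ->
  (forall i j, i != j -> B i `&` B j = set0) ->
  (forall i, (0 <= c i)%R) ->
  (forall i x, B i x -> (c i)%:E <= f x) ->
  (forall i, e%:E <= (c i)%:E * mu (B i)) ->
  (n%:R * e)%:E <= \int[mu]_x f x.
Proof.
move=> f0 mB disj c0 cf ec.
pose g i : T -> \bar R := fun x => (\1_(B i) x)%:E.
have mI i : measurable_fun [set: T] (g i).
  by apply/measurable_EFinP; exact: measurable_indic.
have I0 i x : 0 <= g i x by rewrite lee_fin.
apply: (@le_trans _ _ (\int[mu]_x \sum_(i < n) (c i)%:E * g i x)).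
  rewrite ge0_integral_sum//; last 2 first.
  - by move=> i; apply: emeasurable_funM; [exact: measurable_cst|exact: mI].
  - by move=> i x _; rewrite mule_ge0// lee_fin.
  rewrite (eq_bigr (fun i => (c i)%:E * mu (B i))); last first.
    by move=> i _; rewrite ge0_integralZl_EFin// integral_indic// setIT.
  apply: (@le_trans _ _ (\sum_(i < n) e%:E)); last exact: lee_sum.
  by rewrite sumEFin sumr_const card_ord mulr_natl.
apply: le_ge0_integral => x.
  by apply: sume_ge0 => i _; rewrite mule_ge0 ?lee_fin.
rewrite /g; have [[i Bix]|noB] := pselect (exists i, B i x).
  rewrite (bigD1 i)//= big1 ?adde0 => [|j ji].
    by rewrite indicE mem_set// mule1; exact: cf.
  rewrite indicE memNset ?mule0// => Bjx.
  by have := disj _ _ ji => /seteqP[/(_ x)] + _; apply.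
rewrite big1// => i _; rewrite indicE memNset ?mule0// => Bix.
by apply: noB; exists i.
Qed.

End integral_lower_bound.

Section boxes.
Context {R : realType}.
Local Notation T := (measurableTypeR R).

(** The sides are indexed by [nat] so that dropping a coordinate is a mere shift in the induction on
    n. *)
Definition box n (I : nat -> set R) : set (n.-tuple T) :=
  [set t | forall i : 'I_n, I i (tnth t i)].

Arguments box : clear implicits.

Lemma box_measure n (I : nat -> set R) (l : nat -> R) :
  (forall i, measurable (I i : set T)) ->
  (forall i, lebesgue_measure (I i) = (l i)%:E) ->
  measurable (box n I) /\ lebesgue_tuple n (box n I) = (\prod_(i < n) l i)%:E.
Proof.
elim: n I l => [|n IH] I l mI lI.
  have -> : box 0 I = setT by rewrite -subTset => t _ [].
  by rewrite big_ord0 /= diracE mem_set.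
have [mS lS] := IH (fun i => I i.+1) (fun i => l i.+1) (fun i => mI _) (fun i => lI _).
have mbox : measurable (box n.+1 I).
  rewrite (_ : box _ _ = \bigcap_(i in [set: 'I_n.+1])
      ((fun t : n.+1.-tuple T => tnth t i) @^-1` I i)); last first.
    by apply/seteqP; split=> t /= h i => [_|]; exact: h.
  apply: fin_bigcap_measurable => [|i _]; first exact: finite_finset.
  by rewrite -[X in measurable X]setTI; exact: measurable_tnth.
split=> //.
rewrite /= /lebesgue_step /pushforward.
rewrite (_ : _ @^-1` _ = I 0%N `*` box n (fun i => I i.+1)).
  transitivity (lebesgue_measure (I 0%N) * lebesgue_tuple n (box n (fun i => I i.+1)))%E.
    exact: product_measure1E.
  by rewrite lI lS -EFinM big_ord_recl.
apply/seteqP; split => [[x t] /= h|[x t] /= [h1 h2]].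
  split => [|i]; first exact: (h ord0).
  have := h (lift ord0 i); rewrite (tnth_nth x)/= (tnth_nth x).
  by [].
move=> i; rewrite (tnth_nth x)/=; case: (unliftP ord0 i) => [j ->|->] //=.
by have := h2 j; rewrite (tnth_nth x).
Qed.

End boxes.
Arguments box {R} n I _.

Section bubble_mass.
Context {R : realType} (k : nat) (r : R).
Hypothesis k_ge5 : (5 <= k)%N.
Local Notation N := k.+2.

Let k_gt0 : (0 < k)%N. Proof. exact: leq_trans k_ge5. Qed.
Let k0 : 0 < k%:R :> R. Proof. by rewrite ltr0n. Qed.

(** A box inside the shell s/2 < |x| < s, used in its place because its measure is a plain product.
    The first side alone exceeds s/2; the other coordinates add at most s^2/4 to |x|^2, and 16/25 +
    1/4 < 1. *)
Definition shell_side (s : R) (i : nat) : set R :=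
  if i is 0%N then `[3 / 5 * s, 4 / 5 * s]%classic
  else `[0, s / (2 * N%:R)]%classic.

Lemma shell_box_enorm s (t : N.-tuple (measurableTypeR R)) : 0 < s ->
  box N (shell_side s) t -> s / 2 < enorm (\row_i tnth t i) < s.
Proof.
move=> s0 bt; have N0 : 0 < N%:R :> R by rewrite ltr0n.
have := bt ord0; rewrite /= in_itv/= => /andP[l0 u0].
rewrite /enorm big_ord_recl mxE.
set S := \sum_(i < _) _; set y := tnth t _ in l0 u0 *.
have S0 : 0 <= S by apply: sumr_ge0 => i _; exact: sqr_ge0.
have S1 : S <= s ^+ 2 / 4.
  apply: (@le_trans _ _ (\sum_(i < k.+1) (s / (2 * N%:R)) ^+ 2)).
    apply: ler_sum => i _; rewrite mxE.
    have := bt (lift ord0 i); rewrite /= in_itv/= => /andP[h1 h2].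
    by rewrite lerXn2r ?nnegrE// divr_ge0 ?mulr_ge0 ?(ltW s0).
  rewrite sumr_const card_ord -mulr_natl.
  have n0 : N%:R != 0 :> R by rewrite gt_eqF.
  rewrite [leLHS](_ : _ = s ^+ 2 / 4 * (k.+1%:R / N%:R ^+ 2)); last first.
    by move: N%:R n0 => n n0; field.
  rewrite ger_pMr ?divr_gt0 ?exprn_gt0// ler_pdivrMr ?exprn_gt0// mul1r.
  by rewrite -natrX ler_nat expnS expn1; nia.
have y0 : 0 < y by lra.
have h1 : (3 / 5 * s) ^+ 2 <= y ^+ 2 by rewrite lerXn2r ?nnegrE//; lra.
have h2 : y ^+ 2 <= (4 / 5 * s) ^+ 2 by rewrite lerXn2r ?nnegrE//; lra.
have s20 : 0 < s ^+ 2 by rewrite exprn_gt0.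
apply/andP; split.
  have s2 : 0 < s / 2 by lra.
  by rewrite -(gtr0_norm s2) -sqrtr_sqr ltr_sqrt; lra.
by rewrite -(gtr0_norm s0) -sqrtr_sqr ltr_sqrt; lra.
Qed.

Lemma shell_box_measure s : 0 < s ->
  measurable (box N (shell_side s)) /\
  lebesgue_tuple N (box N (shell_side s)) =
    (5^-1 / (2 * N%:R) ^+ k.+1 * s ^+ k.+2)%:E.
Proof.
move=> s0.
have [] := @box_measure R N (shell_side s)
   (fun i => if i is 0%N then s / 5 else s / (2 * N%:R)).
- by case=> [|i]; exact: measurable_itv.
- case=> [|i]; rewrite lebesgue_measure_itv/= lte_fin.
    rewrite ifT; last by lra.
    by rewrite -EFinB; congr EFin; field.
  rewrite ifT; last by rewrite divr_gt0// mulr_gt0// ltr0n.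
  by rewrite -EFinB subr0.
move=> mB ->; split => //; congr EFin; rewrite big_ord_recl/=.
under eq_bigr do rewrite /=.
rewrite prodr_const card_ord expr_div_n (exprS s k.+1); field.
by rewrite expf_eq0/= mulf_eq0 !pnatr_eq0.
Qed.

Lemma chain_disjoint J (f : nat -> R) : (forall j, (j < J)%N -> 2 * f j <= f j.+1) ->
  (forall j, (j <= J)%N -> 0 < f j) ->
  forall i j, (i < j)%N -> (j <= J)%N -> 2 * f i <= f j.
Proof.
move=> f2 f0 i; elim=> // j IH; rewrite ltnS leq_eqVlt => /predU1P[->|ij] jJ.
  exact: f2.
have := IH ij (ltnW jJ); have := f2 _ jJ; have := f0 _ (ltnW jJ); lra.
Qed.

(** By Harnack |u|^alpha is at least a multiple of s^(-N) on the shell of a bubble s, because alpha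
    = N/2 (p - 2), and the box there has measure v s^N. The powers of s cancel, and factor-two
    separation makes the boxes disjoint. *)
Lemma bubble_mass : 0 < r -> exists2 c0 : R, 0 < c0 &
  forall p (w w1 w2 : R -> R) (u : 'rV[R]_N -> R), nearly_critical k p ->
    radial_solution k r p w w1 w2 ->
    (forall x, oball r x -> u x = w (enorm x)) ->
  forall J (f : nat -> R), (forall j, (j < J)%N -> 2 * f j <= f j.+1) ->
    (forall j, (j <= J)%N -> 0 < f j < r /\ bubble p w (f j)) ->
  ((J.+1%:R * c0)%:E <= \int[lebesgue_tuple N]_t
    (`|(u \_ (oball r)) (\row_i tnth t i)| `^ (N%:R / 2 * (p - 2)))%:E)%E.
Proof.
move=> r0; pose H : R := 2 `^ (2 * (k%:R + r)).
have H1 : 1 <= H.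
  by rewrite -[leLHS](powRr0 2) ler_powR ?ler1n// mulr_ge0// addr_ge0 ?ltW.
have H0 : 0 < H by exact: lt_le_trans H1.
pose h : R := 32^-1 `^ (N%:R / 2) / H `^ (N%:R / 2).
have h0 : 0 < h by rewrite divr_gt0 ?powR_gt0// invr_gt0.
pose v : R := 5^-1 / (2 * N%:R) ^+ k.+1.
have v0 : 0 < v by rewrite divr_gt0 ?invr_gt0// exprn_gt0// mulr_gt0// ltr0n.
exists (h * v) => [|p w w1 w2 u pc sol uw J f f2 fb]; first exact: mulr_gt0.
have f0 j : (j <= J)%N -> 0 < f j by move=> /fb[/andP[]].
have oJ (j : 'I_J.+1) : (j <= J)%N by rewrite -ltnS.
have /andP[p4 p1] := nearly_criticalP k_ge5 pc.
have p2 := gt2_supercritical k_gt0 (proj1 pc).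
have N2 : 0 < N%:R / 2 :> R by rewrite divr_gt0 ?ltr0n.
pose a := N%:R / 2 * (p - 2).
have a0 : 0 < a by rewrite mulr_gt0// subr_gt0.
apply: (@ge0_integral_disjoint_lower _ _ _ _ _ J.+1
  (fun j => box N (shell_side (f j))) (fun j => h / f j ^+ N)).
- by move=> t; rewrite lee_fin powR_ge0.
- by move=> j; have [] := shell_box_measure (f0 _ (oJ j)).
- have disj i j : (i < j)%N -> (j <= J)%N ->
      box N (shell_side (f i)) `&` box N (shell_side (f j)) = set0.
    move=> ij jJ; rewrite -subset0 => t [bi bj].
    have := shell_box_enorm (f0 i (leq_trans (ltnW ij) jJ)) bi.
    have := shell_box_enorm (f0 j jJ) bj.
    by have := chain_disjoint f2 f0 ij jJ; lra.
  move=> i j; rewrite neq_ltn => /orP[ij|ji]; first exact: disj.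
  by rewrite setIC; exact: disj.
- by move=> j; rewrite divr_ge0 ?exprn_ge0 ?ltW// f0.
- move=> j t bt; rewrite lee_fin.
  have [/andP[fj0 fjr] bj] := fb j (oJ j).
  have /andP[xl xu] := shell_box_enorm fj0 bt.
  set x := \row_i _ in xl xu *.
  have bx : oball r x by exact: lt_trans fjr.
  rewrite patchE mem_set// uw//.
  have hw : w (f j) ^+ 2 <= H * w (enorm x) ^+ 2.
    by apply: (harnack k_gt0 (proj1 pc) sol) => //; lra.
  have hf : 32^-1 / f j ^+ 2 <= `|w (f j)| `^ (p - 2).
    by rewrite ler_pdivrMr ?exprn_gt0// mulrC.
  have hf2 : 32^-1 `^ (N%:R / 2) / f j ^+ N <= `|w (f j)| `^ a.
    rewrite /a [N%:R / 2 * _]mulrC (powRrM _ (p - 2)).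
    apply: (@le_trans _ _ ((32^-1 / f j ^+ 2) `^ (N%:R / 2))).
      rewrite powRM ?invr_ge0 ?exprn_ge0 ?(ltW fj0)// ler_wpM2l ?powR_ge0//.
      rewrite -powR_invn ?(ltW fj0)// -powR_invn ?(ltW fj0)// -powRrM.
      by rewrite (_ : - 2%:R * (N%:R / 2) = - N%:R)//; field.
    rewrite ge0_ler_powR ?nnegrE ?powR_ge0 ?(ltW N2)//.
    by rewrite divr_ge0 ?invr_ge0 ?exprn_ge0 ?(ltW fj0).
  have sqE y : `|w y| `^ a = (w y ^+ 2) `^ (a / 2).
    rewrite -[w y ^+ 2]real_normK ?num_real// -powR_mulrn// -powRrM.
    by congr powR; field.
  (* As H >= 1, this replaces the factor H^(a/2) by H^(N/2), which is independent of p. *)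
  have ha : a / 2 <= N%:R / 2.
    rewrite /a; have : N%:R / 2 * (p - 2) <= N%:R / 2 by rewrite ger_pMr.
    by have := N2; lra.
  have : `|w (f j)| `^ a <= H `^ (N%:R / 2) * `|w (enorm x)| `^ a.
    rewrite !sqE; apply: (@le_trans _ _ ((H * w (enorm x) ^+ 2) `^ (a / 2))).
      rewrite ge0_ler_powR ?nnegrE ?sqr_ge0//; first by rewrite divr_ge0// ltW.
      by rewrite mulr_ge0 ?sqr_ge0 ?(ltW H0).
    rewrite powRM ?sqr_ge0 ?(ltW H0)// ler_wpM2r ?powR_ge0//.
    by rewrite ler_powR.
  move/(le_trans hf2); rewrite /h -ler_pdivrMl ?powR_gt0// => hh.
  by apply: le_trans hh; rewrite le_eqVlt; apply/orP; left; apply/eqP; ring.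
- move=> j; have [_ E] := shell_box_measure (f0 _ (oJ j)).
  rewrite [X in (_ * X)%E](_ : _ = (v * f j ^+ k.+2)%:E)//.
  rewrite -EFinM lee_fin le_eqVlt; apply/orP; left; apply/eqP.
  have fn0 : f j ^+ k.+2 != 0 by rewrite expf_neq0// gt_eqF// f0.
  by move: (f j ^+ k.+2) fn0 => F F0; field.
Qed.

End bubble_mass.

(** * Radial functions *)

Section lines.
Context {R : realType}.

Lemma is_derive_line (V : normedModType R) (f : V -> R) (x v : V) (s a : R) :
  is_derive s 1 (fun y => f (x + y *: v)) a <-> is_derive (x + s *: v) v f a.
Proof.
have E h : f (x + (h *: 1 + s) *: v) = f (h *: v + (x + s *: v)).
  by congr f; rewrite -[h *: 1]/(h * 1) mulr1 scalerDl addrCA.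
by split => /is_derive_epsP H; apply/is_derive_epsP => e /H[d d0 Hd]; exists d => // h /Hd;
  rewrite E.
Qed.

Lemma is_derive_line0 (V : normedModType R) (f : V -> R) (x v : V) (a : R) :
  is_derive (0 : R) 1 (fun y => f (x + y *: v)) a -> is_derive x v f a.
Proof. by move/is_derive_line; rewrite scale0r addr0. Qed.

Lemma is_derive_near (f g : R -> R) (x a : R) : (\forall y \near x, f y = g y) ->
  is_derive x 1 f a -> is_derive x 1 g a.
Proof. exact: near_eq_is_derive. Qed.

Lemma is_derive_inv (f : R -> R) (x a : R) : f x != 0 -> is_derive x 1 f a ->
  is_derive x 1 (fun y => (f y)^-1) (- a / f x ^+ 2).
Proof.
move=> fx0 fa; have := is_deriveV fx0 fa.
by rewrite /GRing.scale/= mulNr mulrC -mulNr -exprVn.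
Qed.

Lemma is_derive_unique (V : normedModType R) (f : V -> R) (x v : V) (a b : R) :
  is_derive x v f a -> is_derive x v f b -> a = b.
Proof. by move=> [_ <-] [_ <-]. Qed.

End lines.

Section enorm.
Context {R : realType} {n : nat}.
Implicit Types x y : 'rV[R]_n.

Lemma enorm_ge0 x : 0 <= enorm x. Proof. exact: sqrtr_ge0. Qed.

Lemma enorm_sqr x : enorm x ^+ 2 = \sum_i x 0 i ^+ 2.
Proof. by rewrite sqr_sqrtr// sumr_ge0// => i _; exact: sqr_ge0. Qed.

Lemma enorm_gt0 x : (0 < enorm x) = (x != 0).
Proof.
rewrite sqrtr_gt0 lt0r; have S0 : 0 <= \sum_i x 0 i ^+ 2.
  by rewrite sumr_ge0// => i _; exact: sqr_ge0.
rewrite S0 andbT psumr_eq0; last by move=> i _; exact: sqr_ge0.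
congr (~~ _); apply/allP/eqP => [x0|-> i _]; last by rewrite mxE expr0n/= eqxx.
apply/rowP => i; rewrite mxE; apply/eqP; rewrite -sqrf_eq0.
by apply: x0; rewrite mem_index_enum.
Qed.

Lemma normr_le_enorm x i : `|x 0 i| <= enorm x.
Proof.
rewrite -sqrtr_sqr ler_wsqrtr// (bigD1 i)//= lerDl sumr_ge0// => j _.
exact: sqr_ge0.
Qed.

Lemma enorm_shift_sqr x i h : enorm (x + h *: delta_mx 0 i) ^+ 2 =
  enorm x ^+ 2 + h * (2 * x 0 i) + h ^+ 2.
Proof.
rewrite !enorm_sqr (bigD1 i)//= [in RHS](bigD1 i)//=.
under eq_bigr => j ji do rewrite !mxE/= (negbTE ji) mulr0 addr0.
by rewrite !mxE !eqxx/=; ring.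
Qed.

Lemma enorm_shift x i h : enorm (x + h *: delta_mx 0 i) =
  Num.sqrt (enorm x ^+ 2 + h * (2 * x 0 i) + h ^+ 2).
Proof. by rewrite -enorm_shift_sqr sqrtr_sqr ger0_norm// enorm_ge0. Qed.

Lemma is_derive_enorm x i : x != 0 ->
  is_derive (0 : R) 1 (fun h => enorm (x + h *: delta_mx 0 i)) (x 0 i / enorm x).
Proof.
rewrite -enorm_gt0 => x0.
rewrite (_ : (fun h => _) = fun h => Num.sqrt (enorm x ^+ 2 + h * (2 * x 0 i) + h ^+ 2)); last first.
  by apply/funext => h; exact: enorm_shift.
have dsq : is_derive (0 : R) 1 (fun h => enorm x ^+ 2 + h * (2 * x 0 i) + h ^+ 2) (2 * x 0 i).
  by derive_eq; ring.
have := is_derive_compose (f := Num.sqrt) dsq.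
rewrite mul0r expr0n/= !addr0 => /(_ _ (is_derive1_sqrt (exprn_gt0 2 x0))).
rewrite sqrtr_sqr ger0_norm ?enorm_ge0// => h; apply: is_derive_cast h _.
by field; rewrite gt_eqF.
Qed.

Lemma continuous_enorm_line x i : {for 0, continuous (fun h : R => enorm (x + h *: delta_mx 0 i))}.
Proof.
rewrite (_ : (fun h => _) = Num.sqrt \o fun h => enorm x ^+ 2 + h * (2 * x 0 i) + h ^+ 2); last first.
  by apply/funext => h; exact: enorm_shift.
apply: continuous_comp; last exact: sqrt_continuous.
have dsq : is_derive (0 : R) 1 (fun h => enorm x ^+ 2 + h * (2 * x 0 i) + h ^+ 2) (2 * x 0 i).
  by derive_eq; ring.
exact: is_derive_continuous dsq.
Qed.

Lemma cvg_enorm_line x i :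
  enorm (x + h *: delta_mx 0 i) @[h --> (0 : R)] --> enorm x.
Proof.
have /= := @continuous_enorm_line x i.
by rewrite /prop_for /continuous_at scale0r addr0.
Qed.

Lemma oball_line r x i : oball r x ->
  \forall h \near (0 : R), oball r (x + h *: delta_mx 0 i).
Proof. by move=> xr; exact: (cvgr_lt _ (@cvg_enorm_line x i)). Qed.

Lemma enorm_axis i s : enorm (s *: delta_mx 0 i : 'rV[R]_n) = `|s|.
Proof.
rewrite -(add0r (_ *: _)) enorm_shift enorm_sqr.
rewrite big1 => [|j _]; last by rewrite mxE expr0n.
by rewrite mxE mulr0 mulr0 !add0r sqrtr_sqr.
Qed.

End enorm.

Section radial_reduction.
Context {R : realType} (k : nat) (r : R) (u : 'rV[R]_k.+2 -> R).
Hypothesis r0 : 0 < r.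
Hypothesis uC2 : C2_cball r u.
Hypothesis urad : radial r u.
Local Notation e0 := (delta_mx 0 ord0 : 'rV[R]_k.+2).

Definition profile (s : R) : R := u (s *: e0).
Definition profile1 (s : R) : R := partial ord0 u (s *: e0).
Definition profile2 (s : R) : R := partial ord0 (partial ord0 u) (s *: e0).

Lemma profileE x : cball r x -> u x = profile (enorm x).
Proof.
by move=> xr; apply: urad => //; rewrite /cball/= enorm_axis ger0_norm ?enorm_ge0.
Qed.

Let axis_oball s : - r < s < r -> oball r (s *: e0).
Proof. by move=> sr; rewrite /oball/= enorm_axis ltr_norml. Qed.

Lemma is_derive_profile s : - r < s < r -> is_derive s 1 profile (profile1 s).
Proof.
move=> sr; have [_ d1 _ _ _] := uC2.
have : is_derive (0 + s *: e0) e0 u (profile1 s).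
  by rewrite add0r; apply: DeriveDef => //; exact/d1/axis_oball.
by move/is_derive_line; under eq_fun do rewrite add0r.
Qed.

Lemma is_derive_profile1 s : - r < s < r -> is_derive s 1 profile1 (profile2 s).
Proof.
move=> sr; have [_ _ d2 _ _] := uC2.
have : is_derive (0 + s *: e0) e0 (partial ord0 u) (profile2 s).
  by rewrite add0r; apply: DeriveDef => //; exact/d2/axis_oball.
by move/is_derive_line; under eq_fun do rewrite add0r.
Qed.

(** The profile along an axis is even, since both points s and -s of the axis have norm |s|. *)
Lemma profile1_0 : profile1 0 = 0.
Proof.
have r00 : - r < 0 < r by rewrite oppr_lt0 r0.
have d := is_derive_profile r00.
have nr : \forall y \near (0 : R), `|y| < r.
  by exists r => //= y; rewrite /= sub0r normrN.
have dN : is_derive (0 : R) 1 (fun y => profile (- y)) (profile1 0 * - 1).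
  apply: (is_derive_compose (f := profile) (is_derive_opp (is_derive_ident 0))).
  by rewrite oppr0.
have dE : is_derive (0 : R) 1 (fun y => profile (- y)) (profile1 0).
  apply: near_eq_is_derive d; apply: filterS nr => y yr.
  by apply: urad; rewrite /cball/= !enorm_axis ?normrN// ltW.
by have := is_derive_unique dN dE; lra.
Qed.

Let enorm_itv (x : 'rV[R]_k.+2) : oball r x -> - r < enorm x < r.
Proof.
by move=> xr; rewrite xr andbT (lt_le_trans _ (enorm_ge0 x))// oppr_lt0.
Qed.

Lemma is_derive_radial (x : 'rV[R]_k.+2) i : oball r x -> x != 0 ->
  is_derive x (delta_mx 0 i) u (profile1 (enorm x) * (x 0 i / enorm x)).
Proof.
move=> xr x0; apply: is_derive_line0.
apply: (@is_derive_near _ (fun h => profile (enorm (x + h *: delta_mx 0 i)))).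
  near=> h; rewrite -profileE//; apply/ltW; near: h; exact: oball_line.
have dp : is_derive (enorm (x + 0 *: delta_mx 0 i)) 1 profile (profile1 (enorm x)).
  by rewrite scale0r addr0; apply/is_derive_profile/enorm_itv.
exact: is_derive_compose (is_derive_enorm i x0) dp.
Unshelve. all: by end_near. Qed.

Lemma partial_radial (x : 'rV[R]_k.+2) i : oball r x -> x != 0 ->
  partial i u x = profile1 (enorm x) * (x 0 i / enorm x).
Proof. by move=> xr x0; have [_ <-] := is_derive_radial i xr x0. Qed.

(** The Hessian of a radial function has eigenvalue w'' in the direction x/|x| and w'/|x| in the
    orthogonal ones. *)
Lemma is_derive_radial2 (x : 'rV[R]_k.+2) i j : oball r x -> x != 0 ->
  is_derive x (delta_mx 0 j) (partial i u)
   ((profile2 (enorm x) - profile1 (enorm x) / enorm x) * (x 0 i / enorm x * (x 0 j / enorm x))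
     + (i == j)%:R * (profile1 (enorm x) / enorm x)).
Proof.
move=> xr x0; apply: is_derive_line0; have xp : 0 < enorm x by rewrite enorm_gt0.
apply: (@is_derive_near _ (fun h => profile1 (enorm (x + h *: delta_mx 0 j))
   * ((x 0 i + h * (i == j)%:R) * (enorm (x + h *: delta_mx 0 j))^-1))).
  near=> h; rewrite partial_radial.
  - by rewrite !mxE eqxx/=.
  - by near: h; exact: oball_line.
  - rewrite -enorm_gt0; near: h.
    exact: (cvgr_gt _ (@cvg_enorm_line _ _ x j)).
have dn := is_derive_enorm j x0.
have d1 : is_derive (0 : R) 1 (fun h => profile1 (enorm (x + h *: delta_mx 0 j)))
    (profile2 (enorm x) * (x 0 j / enorm x)).
  have dp : is_derive (enorm (x + 0 *: delta_mx 0 j)) 1 profile1 (profile2 (enorm x)).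
    by rewrite scale0r addr0; apply/is_derive_profile1/enorm_itv.
  exact: is_derive_compose dn dp.
have dV : is_derive (0 : R) 1 (fun h => (enorm (x + h *: delta_mx 0 j))^-1)
    (- (x 0 j / enorm x) / enorm x ^+ 2).
  have n0 : enorm (x + (0 : R) *: delta_mx 0 j) != 0 by rewrite scale0r addr0 gt_eqF.
  have := is_derive_inv (f := fun h : R => enorm (x + h *: delta_mx 0 j)) n0 dn; rewrite scale0r addr0 => h; apply: is_derive_cast h _.
  by field; rewrite gt_eqF.
derive_eq; rewrite scale0r addr0; field; by rewrite gt_eqF.
Unshelve. all: by end_near. Qed.

Lemma partial2_radial (x : 'rV[R]_k.+2) i j : oball r x -> x != 0 ->
  partial j (partial i u) x =
   (profile2 (enorm x) - profile1 (enorm x) / enorm x) * (x 0 i / enorm x * (x 0 j / enorm x))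
     + (i == j)%:R * (profile1 (enorm x) / enorm x).
Proof. by move=> xr x0; have [_ <-] := is_derive_radial2 i j xr x0. Qed.

Lemma laplacian_radial (x : 'rV[R]_k.+2) : oball r x -> x != 0 ->
  laplacian u x = profile2 (enorm x) + (k%:R + 1) * (profile1 (enorm x) / enorm x).
Proof.
move=> xr x0; have xp : 0 < enorm x by rewrite enorm_gt0.
rewrite /laplacian; under eq_bigr => i _.
  rewrite partial2_radial// eqxx mul1r [x 0 i / _ * _](_ : _ = (enorm x)^-2 * x 0 i ^+ 2); last first.
    by field; rewrite gt_eqF.
  over.
rewrite big_split/= -mulr_sumr -mulr_sumr -enorm_sqr sumr_const card_ord -[_ *+ k.+2]mulr_natr.
have -> : k.+2%:R = k%:R + 2 :> R by rewrite -natrD addn2.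
by field; rewrite gt_eqF.
Qed.

Lemma radial_solution_profile p :
  (forall x, oball r x -> - laplacian u x + u x = `|u x| `^ (p - 2) * u x) ->
  radial_solution k r p profile profile1 profile2.
Proof.
move=> ueq; have itv s : 0 <= s < r -> - r < s < r.
  by move=> /andP[s0 ->]; rewrite andbT (lt_le_trans _ s0)// oppr_lt0.
split.
- by move=> s /itv; exact: is_derive_profile.
- by move=> s /itv; exact: is_derive_profile1.
- exact: profile1_0.
- move=> s sr; have /andP[s0 _] := sr.
  have sb : oball r (s *: e0) by apply/axis_oball/itv; rewrite (ltW s0); case/andP: sr.
  have en : enorm (s *: e0) = s by rewrite enorm_axis gtr0_norm.
  have se0 : s *: e0 != 0 by rewrite -enorm_gt0 en.
  have := ueq _ sb; rewrite laplacian_radial// en -/(profile s) => <-.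
  by field; rewrite gt_eqF.
Qed.

End radial_reduction.

(** * Completeness of C2 *)

Section uniform_limits.
Context {R : realType} {X : Type}.
Implicit Types (D : set X).

Definition ucauchy D (f_ : nat -> X -> R) : Prop := forall e, 0 < e -> exists K, forall i j x,
  (K <= i)%N -> (K <= j)%N -> D x -> `|f_ i x - f_ j x| <= e.

Definition pw_lim (f_ : nat -> X -> R) (x : X) : R := lim (f_ n x @[n --> \oo]).

Lemma ucauchy_cvg D (f_ : nat -> X -> R) x : ucauchy D f_ -> D x ->
  f_ n x @[n --> \oo] --> pw_lim f_ x.
Proof.
move=> fD Dx; apply/cauchy_cvgP/cauchy_exP => e e0.
have [K HK] := fD (e / 2) (divr_gt0 e0 (ltr0Sn _ 1)).
exists (f_ K x); exists K => // n /= Kn.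
by apply: le_lt_trans (HK _ _ _ _ _ Dx) _ => //; lra.
Qed.

Lemma ucauchy_lim D (f_ : nat -> X -> R) : ucauchy D f_ -> forall e, 0 < e ->
  exists K, forall i x, (K <= i)%N -> D x -> `|f_ i x - pw_lim f_ x| <= e.
Proof.
move=> fD e e0; have [K HK] := fD e e0; exists K => i x Ki Dx.
have c : `|f_ i x - f_ n x| @[n --> \oo] --> `|f_ i x - pw_lim f_ x|.
  by apply: cvg_norm; apply: cvgB; [exact: cvg_cst|exact: ucauchy_cvg fD Dx].
apply: (cvgr_to_le c); exists K => // n /= Kn; exact: HK.
Qed.

End uniform_limits.

Section derivative_of_limits.
Context {R : realType}.

(** The mean value inequality for f_i - f_K bounds the difference of their difference quotients by
    e/2, uniformly in i. Letting i tend to infinity with K fixed reduces the claim to the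
    differentiability of f_K at 0. *)
Lemma is_derive_limit (f_ g_ : nat -> R -> R) (f g : R -> R) (d : R) : 0 < d ->
  (forall n (h : R), `|h| < d -> is_derive h 1 (f_ n) (g_ n h)) ->
  (forall h, `|h| < d -> f_ n h @[n --> \oo] --> f h) ->
  (forall e, 0 < e -> exists K, forall i h, (K <= i)%N -> `|h| < d ->
     `|g_ i h - g h| <= e) ->
  is_derive (0 : R) 1 f (g 0).
Proof.
move=> d0 dfg cf cg; apply/is_derive_epsP => e e0.
have e4 : 0 < e / 4 by rewrite divr_gt0.
have [K HK] := cg _ e4.
have n0d : `|0 : R| < d by rewrite normr0.
have /is_derive_epsP/(_ _ e4)[d1 d10 Hd1] := dfg K 0 n0d.
exists (Num.min d d1) => [|h /andP[h0]]; first by rewrite lt_min d0.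
rewrite lt_min => /andP[hd hd1]; rewrite -[h *: 1]/(h * 1) mulr1 addr0.
have hn0 : h != 0 by rewrite -normr_gt0.
have mvt i : (K <= i)%N ->
    `|(f_ i h - f_ K h) - (f_ i 0 - f_ K 0)| <= e / 2 * `|h|.
  move=> Ki; pose G x := f_ i x - f_ K x.
  have dG (x : R) : `|x| < d -> is_derive x 1 G (g_ i x - g_ K x).
    by move=> xd; exact: is_derive_sub (dfg _ _ xd) (dfg _ _ xd).
  have bG x : `|x| < d -> `|g_ i x - g_ K x| <= e / 2.
    move=> xd; have := HK i x Ki xd; have := HK K x (leqnn _) xd.
    have := ler_distD (g x) (g_ i x) (g_ K x); rewrite (distrC (g x)).
    lra.
  have key a b : a <= b -> `|a| < d -> `|b| < d -> `|G b - G a| <= e / 2 * (b - a).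
    move=> ab ad bd.
    have abd x : a <= x <= b -> `|x| < d.
      by move: ad bd; rewrite !ltr_norml; lra.
    have h1 : G b - e / 2 * b <= G a - e / 2 * a.
      apply: (@ler0_is_derive_le _ (fun x => G x - e / 2 * x)
        (fun x => g_ i x - g_ K x - e / 2 * 1)) => // x xab.
        exact: is_derive_sub (dG _ (abd _ xab)) (is_derive_scale _ (is_derive_ident x)).
      have xab' : a <= x <= b by lra.
      by have := ler_norm (g_ i x - g_ K x); have := bG _ (abd _ xab'); lra.
    have h2 : G a + e / 2 * a <= G b + e / 2 * b.
      apply: (@ger0_is_derive_le _ (fun x => G x + e / 2 * x)
        (fun x => g_ i x - g_ K x + e / 2 * 1)) => // x xab.
        exact: is_derive_add (dG _ (abd _ xab)) (is_derive_scale _ (is_derive_ident x)).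
      have xab' : a <= x <= b by lra.
      have := ler_norm (- (g_ i x - g_ K x)); have := bG _ (abd _ xab').
      by rewrite normrN; lra.
    by rewrite ler_norml; lra.
  have [hge|hle] := leP 0 h.
    by have := key 0 h hge n0d hd; rewrite subr0 (ger0_norm hge).
  have := key h 0 (ltW hle) hd n0d; rewrite sub0r (ltr0_norm hle).
  by rewrite -normrN opprB.
have lim_mvt : `|(f h - f_ K h) - (f 0 - f_ K 0)| <= e / 2 * `|h|.
  have c : `|(f_ n h - f_ K h) - (f_ n 0 - f_ K 0)| @[n --> \oo]
      --> `|(f h - f_ K h) - (f 0 - f_ K 0)|.
    apply: cvg_norm; apply: cvgB; apply: cvgB; try exact: cvg_cst.
      exact: cf.
    exact: cf.
  by apply: (cvgr_to_le c); exists K => // n /= Kn; exact: mvt.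
have q1 : `|h^-1 * ((f h - f_ K h) - (f 0 - f_ K 0))| <= e / 2.
  by rewrite normrM normfV mulrC ler_pdivrMr.
have := Hd1 h; rewrite h0 hd1 -[h *: 1]/(h * 1) mulr1 addr0 => /(_ isT) q2.
have q3 := HK K 0 (leqnn _) n0d.
rewrite [X in `|X|](_ : _ = h^-1 * ((f h - f_ K h) - (f 0 - f_ K 0))
   + (h^-1 * (f_ K h - f_ K 0) - g_ K 0) + (g_ K 0 - g 0)); last by ring.
apply: le_trans (ler_normD _ _) _.
have := ler_normD (h^-1 * ((f h - f_ K h) - (f 0 - f_ K 0)))
   (h^-1 * (f_ K h - f_ K 0) - g_ K 0).
lra.
Qed.

End derivative_of_limits.

Section C2_completeness.
Context {R : realType} {N : nat} (r : R).
Hypothesis r0 : 0 < r.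
Implicit Types (x : 'rV[R]_N) (f g : 'rV[R]_N -> R).

Lemma is_derive_pw_lim (f_ g_ : nat -> 'rV[R]_N -> R) (i : 'I_N) :
  (forall n x, oball r x -> is_derive x (delta_mx 0 i) (f_ n) (g_ n x)) ->
  ucauchy (oball r) f_ -> ucauchy (oball r) g_ ->
  forall x, oball r x -> is_derive x (delta_mx 0 i) (pw_lim f_) (pw_lim g_ x).
Proof.
move=> dfg cf cg x xr; apply: is_derive_line0.
have [d /= d0 Hd] := oball_line i xr.
have lineb h : `|h| < d -> oball r (x + h *: delta_mx 0 i).
  by move=> hd; apply: Hd; rewrite /= sub0r normrN.
have := @is_derive_limit _ (fun n h => f_ n (x + h *: delta_mx 0 i))
  (fun n h => g_ n (x + h *: delta_mx 0 i))
  (fun h => pw_lim f_ (x + h *: delta_mx 0 i))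
  (fun h => pw_lim g_ (x + h *: delta_mx 0 i)) d d0.
rewrite scale0r addr0; apply.
- by move=> n h /lineb hb; apply/is_derive_line/dfg.
- by move=> h /lineb hb; exact: ucauchy_cvg cf hb.
- move=> e e0; have [K HK] := ucauchy_lim cg e0.
  by exists K => k h Kk /lineb hb; exact: HK.
Qed.

Lemma cball_oball x d : cball r x -> 0 < d ->
  exists2 s : R, 0 < s < d & oball r ((1 - s) *: x).
Proof.
move=> xr d0; pose s := Num.min (d / 2) (1 / 2).
have s0 : 0 < s by rewrite lt_min !divr_gt0.
have s1 : s <= 1 / 2 by rewrite ge_min lexx orbT.
have sd : s <= d / 2 by rewrite ge_min lexx.
exists s; first by lra.
have -> : oball r ((1 - s) *: x) = (enorm ((1 - s) *: x) < r) by [].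
have -> : enorm ((1 - s) *: x) = (1 - s) * enorm x.
  have s1' : 0 <= 1 - s by lra.
  rewrite /enorm; under eq_bigr do rewrite mxE exprMn.
  by rewrite -mulr_sumr sqrtrM ?sqr_ge0// sqrtr_sqr ger0_norm.
have [->|xn0] := eqVneq (enorm x) 0; first by rewrite mulr0.
have xp : 0 < enorm x by rewrite lt0r xn0 enorm_ge0.
by apply: lt_le_trans xr; rewrite gtr_pMl//; lra.
Qed.

(** A point x of the closed ball is the limit of the points (1 - s) x of the open ball. *)
Lemma within_cball_le f (c : R) : {within cball r, continuous f} ->
  (forall x, oball r x -> `|f x| <= c) -> forall x, cball r x -> `|f x| <= c.
Proof.
move=> /subspace_continuousP cf fc x xr; apply/ler_addgt0Pr => e e0.
have /cvgrPdist_le /(_ _ e0) := cf x xr.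
rewrite /within/= => /nbhs_ballP[d /= d0 Hd].
have x1 : 0 < `|x| + 1 by rewrite ltr_wpDl.
have [s /andP[s0 sd] sb] := cball_oball xr (divr_gt0 d0 x1).
have xd : ball x d ((1 - s) *: x).
  rewrite -ball_normE/= scalerBl scale1r opprB addrC subrK normrZ gtr0_norm//.
  move: sd; rewrite ltr_pdivlMr// => sd; apply: le_lt_trans sd.
  by rewrite ler_pM2l// lerDl.
have := Hd _ xd (ltW sb); have := fc _ sb.
by have := ler_distD (f ((1 - s) *: x)) (f x) 0; rewrite !subr0; lra.
Qed.

Lemma ucauchy_cball (f_ : nat -> 'rV[R]_N -> R) :
  (forall n, {within cball r, continuous (f_ n)}) ->
  ucauchy (oball r) f_ -> ucauchy (cball r) f_.
Proof.
move=> cf fD e e0; have [K HK] := fD e e0; exists K => i j x Ki Kj.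
apply: (@within_cball_le (fun y => f_ i y - f_ j y)) => [|y yr]; last exact: HK.
by apply/subspace_continuousP => y yr; apply: cvgB; apply/subspace_continuousP: y yr; exact: cf.
Qed.

Lemma continuous_pw_lim (f_ : nat -> 'rV[R]_N -> R) :
  (forall n, {within cball r, continuous (f_ n)}) ->
  ucauchy (cball r) f_ -> {within cball r, continuous (pw_lim f_)}.
Proof.
move=> cf fD; apply/subspace_continuousP => x xr; apply/cvgrPdist_le => e e0.
have e3 : 0 < e / 3 by rewrite divr_gt0.
have [K HK] := ucauchy_lim fD e3.
have /subspace_continuousP/(_ x xr)/cvgrPdist_le/(_ _ e3) := cf K.
rewrite !near_withinE; apply: filterS => y Hy yr.
rewrite -[leLHS]/(`|pw_lim f_ x - pw_lim f_ y|).
have : `|f_ K x - f_ K y| <= e / 3 := Hy yr; have := HK K x (leqnn _) xr; have := HK K y (leqnn _) yr.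
have := ler_distD (f_ K x) (pw_lim f_ x) (pw_lim f_ y).
have := ler_distD (f_ K y) (f_ K x) (pw_lim f_ y).
rewrite (distrC (pw_lim f_ x) (f_ K x)); lra.
Qed.

(** The extensions are again uniformly Cauchy on the closed ball, by density of the open ball, so
    their limit is continuous and extends that of the [f_]. *)
Lemma extends_continuously_pw_lim (f_ : nat -> 'rV[R]_N -> R) :
  (forall n, extends_continuously r (f_ n)) ->
  ucauchy (oball r) f_ -> extends_continuously r (pw_lim f_).
Proof.
move=> fext fD.
have /boolp.choice[g Hg] n : exists g : 'rV[R]_N -> R,
    {within cball r, continuous g} /\ forall x, oball r x -> g x = f_ n x.
  by have [g cg gf] := fext n; exists g.
have cg n : {within cball r, continuous (g n)} by have [] := Hg n.
have gf n x : oball r x -> g n x = f_ n x by move: n x => n x; have [_] := Hg n; exact.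
have gD : ucauchy (cball r) g.
  apply: ucauchy_cball => // e /fD[K HK]; exists K => i j x Ki Kj xr.
  by rewrite !gf//; exact: HK.
exists (pw_lim g); first exact: continuous_pw_lim.
by move=> x xr; rewrite /pw_lim; congr (lim _); under eq_fun do rewrite gf//.
Qed.

Lemma extends_continuously_eq f g : (forall x, oball r x -> f x = g x) ->
  extends_continuously r f -> extends_continuously r g.
Proof. by move=> fg [h ch hf]; exists h => // x xr; rewrite hf// fg. Qed.

Lemma sup_norm_le f (c : R) : 0 <= c -> (forall x, oball r x -> `|f x| <= c) ->
  0 <= sup_norm r f <= c.
Proof.
move=> c0 fc; rewrite /sup_norm.
have o0 : oball r (0 : 'rV[R]_N).
  rewrite /oball/= /enorm big1 ?sqrtr0// => i _; by rewrite mxE expr0n.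
have ub : ubound [set `|f x| | x in oball r] c by move=> _ [x xr <-]; exact: fc.
apply/andP; split; last by apply: ge_sup => //; exists `|f 0|; exists 0.
apply: (@le_trans _ _ `|f 0|); first exact: normr_ge0.
by apply: ub_le_sup; [exists c|exists 0].
Qed.

Lemma is_derive_near_oball f g x i (a : R) : oball r x ->
  (forall y, oball r y -> f y = g y) ->
  is_derive x (delta_mx 0 i) f a -> is_derive x (delta_mx 0 i) g a.
Proof.
move=> xr fg df; apply: is_derive_line0.
have : is_derive (0 : R) 1 (fun h => f (x + h *: delta_mx 0 i)) a.
  by apply/is_derive_line; rewrite scale0r addr0.
apply: is_derive_near; apply: filterS (oball_line i xr) => h; exact: fg.
Qed.

Lemma cvg_sum0 (I : finType) (F : I -> nat -> R) :
  (forall i, F i n @[n --> \oo] --> (0 : R)) ->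
  \sum_i F i n @[n --> \oo] --> (0 : R).
Proof.
move=> F0; rewrite [X in _ --> X](_ : 0 = \sum_(i : I) (0 : R)); last by rewrite big1.
by apply: cvg_big => //; exact: add_continuous.
Qed.

Lemma C2_complete (v_ : nat -> 'rV[R]_N -> R) :
  (forall n, C2_cball r (v_ n)) ->
  ucauchy (oball r) v_ ->
  (forall i, ucauchy (oball r) (fun n => partial i (v_ n))) ->
  (forall i j, ucauchy (oball r) (fun n => partial j (partial i (v_ n)))) ->
  exists v, C2_cvg r v_ v.
Proof.
move=> vC2 c0 c1 c2; pose v := pw_lim v_.
have d1v n i x : oball r x -> is_derive x (delta_mx 0 i) (v_ n) (partial i (v_ n) x).
  by move=> xr; have [_ h _ _ _] := vC2 n; exact: DeriveDef (h x i xr) erefl.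
have d2v n i j x : oball r x ->
    is_derive x (delta_mx 0 j) (partial i (v_ n)) (partial j (partial i (v_ n)) x).
  by move=> xr; have [_ _ h _ _] := vC2 n; exact: DeriveDef (h x i j xr) erefl.
have dv i x : oball r x ->
    is_derive x (delta_mx 0 i) v (pw_lim (fun n => partial i (v_ n)) x).
  exact: (is_derive_pw_lim (fun n y => @d1v n i y) c0 (c1 i)).
have pv i x : oball r x -> pw_lim (fun n => partial i (v_ n)) x = partial i v x.
  by move=> /(dv i)[_ <-].
(* The limit of the first partials equals [partial i v] on the open ball only, so its derivative is
   transferred by locality. *)
have ddv i j x : oball r x -> is_derive x (delta_mx 0 j) (partial i v)
    (pw_lim (fun n => partial j (partial i (v_ n))) x).
  move=> xr; apply: (is_derive_near_oball xr (pv i)).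
  exact: (is_derive_pw_lim (fun n y => @d2v n i j y) (c1 i) (c2 i j)).
have ppv i j x : oball r x ->
    pw_lim (fun n => partial j (partial i (v_ n))) x = partial j (partial i v) x.
  by move=> /(ddv i j)[_ <-].
have vv : C2_cball r v.
  split.
  - apply: continuous_pw_lim; last apply: ucauchy_cball => //.
      by move=> n; have [] := vC2 n.
    by move=> n; have [] := vC2 n.
  - by move=> x i /(dv i) h; exact: ex_derive.
  - by move=> x i j /(ddv i j) h; exact: ex_derive.
  - move=> i; apply: (extends_continuously_eq (pv i)).
    by apply: extends_continuously_pw_lim => // n; have [] := vC2 n.
  - move=> i j; apply: (extends_continuously_eq (ppv i j)).
    by apply: (@extends_continuously_pw_lim (fun n => partial j (partial i (v_ n)))) => // n; have [] := vC2 n.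
exists v; split => //.
have s0 : sup_norm r (v_ k \- v) @[k --> \oo] --> (0 : R).
  apply/cvgrPdist_le => e e0; have [K HK] := ucauchy_lim c0 e0.
  exists K => // k /= Kk; rewrite sub0r normrN.
  have /andP[h0 h1] := @sup_norm_le (v_ k \- v) e (ltW e0) (fun x => HK k x Kk).
  by rewrite ger0_norm.
have pB n i x : oball r x -> partial i (v_ n \- v) x = partial i (v_ n) x - partial i v x.
  move=> xr; have h1 := d1v n i x xr; have h2 := dv i x xr.
  by rewrite -(pv i)//; have [_ <-] := is_deriveB h1 h2.
have s1 i : sup_norm r (partial i (v_ k \- v)) @[k --> \oo] --> (0 : R).
  apply/cvgrPdist_le => e e0; have [K HK] := ucauchy_lim (c1 i) e0.
  exists K => // k /= Kk; rewrite sub0r normrN.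
  have /andP[h0 h1] : 0 <= sup_norm r (partial i (v_ k \- v)) <= e.
    by apply: sup_norm_le (ltW e0) _ => x xr; rewrite pB// -pv//; exact: HK.
  by rewrite ger0_norm.
have s2 i j : sup_norm r (partial j (partial i (v_ k \- v))) @[k --> \oo] --> (0 : R).
  apply/cvgrPdist_le => e e0; have [K HK] := ucauchy_lim (c2 i j) e0.
  exists K => // k /= Kk; rewrite sub0r normrN.
  have /andP[h0 h1] : 0 <= sup_norm r (partial j (partial i (v_ k \- v))) <= e.
    apply: sup_norm_le (ltW e0) _ => x xr.
    have fE y : oball r y ->
        (partial i (v_ k) - partial i v) y = partial i (v_ k \- v) y.
      by move=> yr; rewrite pB.
    have h := is_derive_near_oball xr fE (is_deriveB (d2v k i j x xr) (ddv i j x xr)).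
    have hv : partial j (partial i (v_ k \- v)) x = _ := @derive_val _ _ _ _ _ _ _ h.
    by rewrite hv; exact: HK.
  by rewrite ger0_norm.
rewrite /C2_norm -[X in _ --> X](addr0 0) -[X in _ --> X + _](addr0 0).
apply: cvgD; first by apply: cvgD => //; exact: cvg_sum0.
exact: (cvg_sum0 (fun i => cvg_sum0 (s2 i))).
Qed.

End C2_completeness.

(** * Continuous dependence *)

Section nonlinearity.
Context {R : realType}.
Implicit Types a b s t B : R.

Let powR_le_bound a s B : 0 <= a -> 0 < s <= 1 -> 1 <= B -> a <= B -> a `^ s <= B.
Proof.
move=> a0 /andP[s0 s1] B1 aB; have B0 : 0 <= B := le_trans ler01 B1.
apply: (@le_trans _ _ (B `^ s)); first by rewrite ge0_ler_powR ?nnegrE// ltW.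
exact: ler1_powR.
Qed.

Lemma powR_lipschitz_ge0 s a b B : 0 < s <= 1 -> 1 <= B -> 0 <= b -> b <= a ->
  a <= B -> 0 <= a `^ s * a - b `^ s * b <= 2 * B * (a - b).
Proof.
move=> s01 B1 b0 ba aB; have /andP[s0 s1] := s01; have a0 := le_trans b0 ba.
have mono : b `^ s <= a `^ s by rewrite ge0_ler_powR ?nnegrE// ltW.
have aB' := powR_le_bound a0 s01 B1 aB.
have bB' := powR_le_bound b0 s01 B1 (le_trans ba aB).
(* Because s <= 1, x^(s-1) is nonincreasing. This is what bounds a^(s+1) - b^(s+1) by (a^s + b^s) (a
   - b). *)
have key : b * a `^ s <= a * b `^ s.
  have [->|bn0] := eqVneq b 0; first by rewrite mul0r mulr_ge0 ?powR_ge0.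
  have bp : 0 < b by rewrite lt0r bn0.
  have ap : 0 < a := lt_le_trans bp ba.
  have E x : 0 < x -> x = x `^ (1 - s) * x `^ s.
    move=> x0; rewrite -powRD; last by rewrite (gt_eqF x0) implybT.
    by rewrite subrK powRr1// ltW.
  rewrite {1}(E b)// {2}(E a)// -mulrA -[leRHS]mulrA [X in _ <= _ * X]mulrC.
  rewrite ler_wpM2r ?mulr_ge0 ?powR_ge0// ge0_ler_powR ?nnegrE//.
  by rewrite subr_ge0.
apply/andP; split; first by rewrite subr_ge0 ler_pM ?powR_ge0.
apply: (@le_trans _ _ ((a `^ s + b `^ s) * (a - b))); first by lra.
by rewrite ler_wpM2r ?subr_ge0//; lra.
Qed.

Lemma abs_powR_lipschitz s a b B : 0 < s <= 1 -> 1 <= B -> `|a| <= B -> `|b| <= B ->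
  `| `|a| `^ s * a - `|b| `^ s * b| <= 2 * B * `|a - b|.
Proof.
move=> s01 B1; wlog ba : a b / b <= a => [H aB bB|].
  have [ba|/ltW ab] := leP b a; first exact: H.
  by rewrite distrC (distrC a b); exact: H.
move=> aB bB; rewrite [X in _ <= _ * X]ger0_norm ?subr_ge0//.
have [b0|b0] := leP 0 b.
  have a0 := le_trans b0 ba; rewrite (ger0_norm a0) (ger0_norm b0) in aB bB *.
  have /andP[h1 h2] := powR_lipschitz_ge0 s01 B1 b0 ba aB.
  by rewrite ger0_norm.
have [a0|a0] := leP a 0.
  rewrite (ler0_norm a0) (ltr0_norm b0) in aB bB *.
  have := @powR_lipschitz_ge0 s (- b) (- a) B s01 B1.
  rewrite oppr_ge0 lerN2 => /(_ a0 ba bB) /andP[h1 h2].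
  by rewrite ger0_norm; lra.
have := powR_le_bound (normr_ge0 a) s01 B1 aB.
have := powR_le_bound (normr_ge0 b) s01 B1 bB.
have := powR_ge0 `|a| s; have := powR_ge0 `|b| s.
move: (`|a| `^ s) (`|b| `^ s) => A A' A'0 A0 A'B AB.
have h1 : 0 <= A * a by rewrite mulr_ge0// ltW.
have h2 : A * a <= B * a by rewrite ler_wpM2r// ltW.
have h3 : 0 <= A' * - b by rewrite mulr_ge0// oppr_ge0 ltW.
have h4 : A' * - b <= B * - b by rewrite ler_wpM2r// oppr_ge0 ltW.
have h5 : 0 <= B * (a - b) by rewrite mulr_ge0//; lra.
by rewrite ger0_norm; lra.
Qed.

Lemma expR_sub_le (x y : R) : expR x - expR y <= (x - y) * expR x.
Proof.
have := expR_ge1Dx (y - x).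
rewrite expRD expRN => h.
have := ler_wpM2r (expR_ge0 x) h; rewrite mulfVK ?gt_eqF ?expR_gt0//.
by lra.
Qed.

(** Convexity of exp bounds x^s - x^t by |s - t| |ln x| B; the remaining factor x tames the
    logarithm at 0. *)
Lemma abs_powR_exponent s t a B : 0 < s <= 1 -> 0 < t <= 1 -> 1 <= B -> `|a| <= B ->
  `| `|a| `^ s * a - `|a| `^ t * a| <= B ^+ 3 * `|s - t|.
Proof.
move=> + + B1 aB; wlog ts : s t / t <= s => [H s01 t01|].
  have [ts|/ltW st] := leP t s; first exact: H.
  by rewrite distrC (distrC s t); exact: H.
move=> s01 t01; have B0 : 0 <= B by lra.
rewrite -mulrBl normrM (ger0_norm (_ : 0 <= s - t)) ?subr_ge0//.
have [->|an0] := eqVneq a 0.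
  by rewrite normr0 mulr0 mulr_ge0 ?exprn_ge0 ?subr_ge0.
have x0 : 0 < `|a| by rewrite normr_gt0.
move: `|a| x0 aB => x x0 xB {a an0}.
have xsB := powR_le_bound (ltW x0) s01 B1 xB.
have xtB := powR_le_bound (ltW x0) t01 B1 xB.
(* For x >= 1 use ln x <= x; for x < 1 use - ln x <= 1/x - 1, which gives x |ln x| <= 1. *)
have lnB : x * `|ln x| <= B ^+ 2.
  have B2 : B <= B ^+ 2 by rewrite expr2 ler_peMl.
  have [l0|l0] := leP 0 (ln x).
    have := expR_ge1Dx (ln x); rewrite lnK ?posrE// => h.
    by rewrite expr2 ler_pM ?(ltW x0) ?(ger0_norm l0)//; lra.
  have := expR_ge1Dx (- ln x); rewrite expRN lnK ?posrE// => h.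
  have := ler_wpM2l (ltW x0) h; rewrite mulfV ?gt_eqF// (ltr0_norm l0).
  by lra.
have st0 : 0 <= s - t by lra.
have B20 : 0 <= B ^+ 2 by rewrite exprn_ge0.
have bound y : y <= (s - t) * `|ln x| * B -> y * x <= B ^+ 3 * (s - t).
  move=> yB; apply: (@le_trans _ _ ((s - t) * `|ln x| * B * x)).
    by rewrite ler_wpM2r// ltW.
  rewrite [leLHS](_ : _ = (s - t) * (B * (x * `|ln x|))); last by ring.
  by rewrite [leRHS]mulrC ler_wpM2l// exprS ler_wpM2l.
apply: bound; rewrite ler_norml.
have E z : x `^ z = expR (z * ln x) by rewrite /powR gt_eqF.
have dle y z : `|y - z| = s - t -> x `^ y <= B -> x `^ y - x `^ z <= (s - t) * `|ln x| * B.
  move=> yz yB; rewrite !E; apply: le_trans (expR_sub_le _ _) _.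
  rewrite -mulrBl -E; apply: (@le_trans _ _ (`|(y - z) * ln x| * x `^ y)).
    by rewrite ler_wpM2r ?powR_ge0// ler_norm.
  by rewrite normrM yz ler_wpM2l// mulr_ge0.
have h1 := dle s t (ger0_norm st0) xsB.
have h2 := dle t s _ xtB; rewrite distrC in h2; have {}h2 := h2 (ger0_norm st0).
by apply/andP; split; lra.
Qed.

End nonlinearity.

(** Here y and z are the differences of w' and w, and b = (k+1)/s. The singular term enters with the
    sign of damping and is dropped. Including eps^2 in the quantity makes the inequality
    homogeneous, with no source term. *)
Lemma gronwall_rate {R : realType} (l eps b H y z : R) : 0 <= l -> 0 <= eps -> 0 <= b ->
  `|H| <= l * `|z| + eps ->
  2 * y * (H - b * y) + 2 * z * y - (l + 2) * (y ^+ 2 + z ^+ 2 + eps ^+ 2) <= 0.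
Proof.
move=> l0 eps0 b0 Hle.
have yH : y * H <= `|y| * (l * `|z| + eps).
  by apply: le_trans (ler_norm _) _; rewrite normrM ler_wpM2l.
have by2 := mulr_ge0 b0 (sqr_ge0 y).
have leps := mulr_ge0 l0 (sqr_ge0 eps).
have yz : l * (2 * (`|y| * `|z|)) <= l * (y ^+ 2 + z ^+ 2).
  rewrite ler_wpM2l// -[y ^+ 2]real_normK ?num_real// -[z ^+ 2]real_normK ?num_real//.
  by have := sqr_ge0 (`|y| - `|z|); lra.
have yeps : 2 * (`|y| * eps) <= y ^+ 2 + eps ^+ 2.
  rewrite -[y ^+ 2]real_normK ?num_real//.
  by have := sqr_ge0 (`|y| - eps); lra.
have zy : 2 * (z * y) <= z ^+ 2 + y ^+ 2 by have := sqr_ge0 (z - y); lra.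
by have := sqr_ge0 eps; have := sqr_ge0 z; lra.
Qed.

Section continuous_dependence.
Context {R : realType} (k : nat) (r : R).
Hypothesis k_ge5 : (5 <= k)%N.


Let k_gt0 : (0 < k)%N. Proof. exact: leq_trans k_ge5. Qed.
Let k0 : 0 < k%:R :> R. Proof. by rewrite ltr0n. Qed.

(** The bound on w1 - v1 carries a factor s because the Hessian of a radial function contains
    w'/|x|; it comes from [radial_quotient_bound] rather than from Gronwall. The bound on w2 - v2 is
    then read off the equation. *)
Lemma continuous_dependence B e : 1 <= B -> 0 < e -> exists2 d, 0 < d &
  forall p q (w w1 w2 v v1 v2 : R -> R), nearly_critical k p -> nearly_critical k q ->
    radial_solution k r p w w1 w2 -> radial_solution k r q v v1 v2 ->
    (forall s, 0 <= s < r -> `|w s| <= B) -> (forall s, 0 <= s < r -> `|v s| <= B) ->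
    `|w 0 - v 0| <= d -> `|p - q| <= d ->
  forall s, 0 < s < r ->
    [/\ `|w s - v s| <= e, `|w1 s - v1 s| <= e * s & `|w2 s - v2 s| <= e].
Proof.
move=> B1 e0; pose l : R := 1 + 2 * B.
have l1 : 1 <= l by rewrite /l; lra.
have B0 : 0 < B by lra.
have lk : 0 < (l + 1) * (k%:R + 2).
  by apply: mulr_gt0; have := k0; lra.
(* If w - v and eps are at most e1, the right-hand sides differ by at most (l + 1) e1, and adding (k
   + 1) times the bound on (w1 - v1)/s gives the factor k + 2. *)
pose e1 := e / ((l + 1) * (k%:R + 2)).
have e10 : 0 < e1 by rewrite divr_gt0.
have e1e : (k%:R + 2) * ((l + 1) * e1) = e.
  rewrite /e1; field; apply/andP; split; first by rewrite gt_eqF//; have := k0; lra.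
  by rewrite gt_eqF//; lra.
have l10 : 0 <= (l + 1) * e1 by apply: mulr_ge0; [lra|exact: ltW].
have e1e' : (l + 1) * e1 <= e.
  rewrite -e1e -[leLHS]mul1r; apply: ler_wpM2r => //.
  by have := k0; lra.
have e1e'' : e1 <= e by apply: le_trans e1e'; rewrite ler_peMl ?(ltW e10)//; lra.
pose G := expR ((l + 2) * r); have G0 : 0 < G by exact: expR_gt0.
pose A := 1 + B ^+ 3; have A1 : 1 <= A by rewrite lerDl exprn_ge0// ltW.
(* Both |w(0) - v(0)| and eps are at most d A, so E(0) G <= 2 (d A)^2 G. The first term of the
   minimum gives d A <= e1, and the product of both bounds gives E(0) G <= e1^2. *)
pose d := Num.min (e1 / A) (e1 / A / (1 + 2 * A ^+ 2 * G)).
have A0 : 0 < A by lra.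
have D0 : 0 < 1 + 2 * A ^+ 2 * G by rewrite addr_gt0// mulr_gt0// mulr_gt0// exprn_gt0.
have d0 : 0 < d by rewrite lt_min !divr_gt0.
exists d => // p q w w1 w2 v v1 v2 pc qc wsol vsol wB vB wv0 pq.
have /andP[p4 p1] := nearly_criticalP k_ge5 pc.
have /andP[q4 q1] := nearly_criticalP k_ge5 qc.
have p2 := gt2_supercritical k_gt0 (proj1 pc).
have q2 := gt2_supercritical k_gt0 (proj1 qc).
have p01 : 0 < p - 2 <= 1 by rewrite subr_gt0 p2.
have q01 : 0 < q - 2 <= 1 by rewrite subr_gt0 q2.
pose eps := B ^+ 3 * `|p - q|.
pose h s := (w s - `|w s| `^ (p - 2) * w s) - (v s - `|v s| `^ (q - 2) * v s).
have eps0 : 0 <= eps by rewrite mulr_ge0 ?exprn_ge0 ?(ltW B0).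
have hle s : 0 <= s < r -> `|h s| <= l * `|w s - v s| + eps.
  move=> sr; have a1 := abs_powR_lipschitz p01 B1 (wB s sr) (vB s sr).
  have := abs_powR_exponent p01 q01 B1 (vB s sr).
  rewrite (_ : p - 2 - (q - 2) = p - q); last by ring.
  rewrite -/eps => a2.
  rewrite /h [X in `|X|](_ : _ = (w s - v s)
    - (`|w s| `^ (p - 2) * w s - `|v s| `^ (p - 2) * v s)
    - (`|v s| `^ (p - 2) * v s - `|v s| `^ (q - 2) * v s)); last by ring.
  apply: le_trans (ler_normB _ _) _.
  have := ler_normB (w s - v s) (`|w s| `^ (p - 2) * w s - `|v s| `^ (p - 2) * v s).
  by rewrite /l; lra.
pose E s := (w1 s - v1 s) ^+ 2 + (w s - v s) ^+ 2 + eps ^+ 2.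
have E_ge0 s : 0 <= E s by rewrite !addr_ge0 ?sqr_ge0.
have ode s : 0 < s < r -> w2 s - v2 s = h s - (k%:R + 1) * (w1 s - v1 s) / s.
  move=> sr; have /andP[s0 _] := sr; have sn0 : s != 0 by rewrite gt_eqF.
  have a1 := rs_ode wsol sr; have a2 := rs_ode vsol sr.
  apply: (mulfI sn0); rewrite mulrBr a1 a2 /h; by field.
have gronwall s : 0 <= s < r -> E s <= E 0 * G.
  move=> /andP[s0 sr].
  have dexp (x : R) : is_derive x 1 (fun y : R => expR (- (l + 2) * y))
      (expR (- (l + 2) * x) * (- (l + 2) * 1)).
    exact: (is_derive_compose (f := expR) (is_derive_scale _ (is_derive_ident x)) (is_derive_expR _)).
  have : E s * expR (- (l + 2) * s) <= E 0 * expR (- (l + 2) * 0).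
    apply: (@ler0_is_derive_le _ (fun x => E x * expR (- (l + 2) * x)) (fun x =>
      E x * (expR (- (l + 2) * x) * (- (l + 2) * 1)) + expR (- (l + 2) * x) *
        (2%:R * (w1 x - v1 x) ^+ 1 * (w2 x - v2 x)
         + 2%:R * (w x - v x) ^+ 1 * (w1 x - v1 x) + 0))) => //.
      move=> x /andP[x0 xs]; have xr : 0 <= x < r by rewrite x0 (le_lt_trans xs).
      have a1 := rs_der1 wsol xr; have a2 := rs_der2 wsol xr.
      have b1 := rs_der1 vsol xr; have b2 := rs_der2 vsol xr.
      have := dexp x => a3; rewrite /E; derive.
    move=> x /andP[x0 xs]; have xr : 0 < x < r by rewrite x0 (lt_trans xs).
    have xr' : 0 <= x < r by rewrite (ltW x0); case/andP: xr.
    rewrite /= [leLHS](_ : _ = expR (- (l + 2) * x) * (2 * (w1 x - v1 x) * (w2 x - v2 x)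
       + 2 * (w x - v x) * (w1 x - v1 x) - (l + 2) * E x)); last by ring.
    rewrite pmulr_rle0 ?expR_gt0// ode// /E.
    have := hle _ xr'.
    move: (w1 x - v1 x) (w x - v x) (h x) => y z H Hle.
    rewrite [(k%:R + 1) * y / x]mulrAC; apply: gronwall_rate => //; first by lra.
    by rewrite divr_ge0 ?(ltW x0)// addr_ge0// ltW.
  rewrite mulr0 expR0 mulr1 mulNr expRN ler_pdivrMr ?expR_gt0// => /le_trans; apply.
  rewrite ler_wpM2l// /G ler_expR ler_wpM2l//; first lra.
  exact: ltW.
have E0 : E 0 * G <= e1 ^+ 2.
  rewrite /E (rs_der1_0 wsol) (rs_der1_0 vsol) subrr expr0n/= add0r.
  have dd : d * (1 + 2 * A ^+ 2 * G) * A <= e1.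
    by rewrite -ler_pdivlMr// -ler_pdivlMr// ge_min lexx orbT.
  have dA : d * A <= e1 by rewrite -ler_pdivlMr// ge_min lexx.
  have a1 : (w 0 - v 0) ^+ 2 <= (d * A) ^+ 2.
    rewrite -[leLHS]real_normK ?num_real// ler_sqr ?nnegrE ?mulr_ge0 ?(ltW d0) ?(ltW A0)//.
    by apply: le_trans wv0 _; rewrite ler_peMr// ltW.
  have a2 : eps ^+ 2 <= (d * A) ^+ 2.
    rewrite ler_sqr ?nnegrE ?eps0 ?mulr_ge0 ?(ltW d0) ?(ltW A0)//.
    rewrite /eps mulrC ler_pM ?exprn_ge0 ?(ltW B0)//.
    by rewrite /A; lra.
  apply: (@le_trans _ _ (2 * (d * A) ^+ 2 * G)).
    by rewrite ler_wpM2r ?(ltW G0)//; lra.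
  apply: (@le_trans _ _ (d * A * (d * (1 + 2 * A ^+ 2 * G) * A))).
    rewrite -subr_ge0 [leRHS](_ : _ = d ^+ 2 * A ^+ 2 * (1 + 2 * G * (A ^+ 2 - 1))); last by ring.
    have A2 : 1 <= A ^+ 2 by rewrite exprn_ege1.
    apply: mulr_ge0; first by apply: mulr_ge0; exact: sqr_ge0.
    have A20 : 0 <= A ^+ 2 - 1 by lra.
    by have := mulr_ge0 (ltW G0) A20; lra.
  have dA0 : 0 <= d * A by apply: mulr_ge0; exact: ltW.
  rewrite expr2; apply: ler_pM => //; rewrite mulrAC.
  by apply: mulr_ge0 => //; exact: ltW.
have wv s : 0 <= s < r -> `|w s - v s| <= e1.
  move=> sr; rewrite -ler_sqr ?nnegrE ?(ltW e10)// real_normK ?num_real//.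
  apply: le_trans E0; apply: le_trans (gronwall s sr).
  by rewrite /E; have := sqr_ge0 (w1 s - v1 s); have := sqr_ge0 eps; lra.
have epse : eps <= e1.
  have dA : d * A <= e1 by rewrite -ler_pdivlMr// ge_min lexx.
  apply: le_trans dA; rewrite /eps mulrC ler_pM ?exprn_ge0 ?(ltW B0)//.
  by rewrite /A; lra.
have hB s : 0 <= s < r -> `|h s| <= (l + 1) * e1.
  move=> sr; apply: le_trans (hle s sr) _.
  have l0 : 0 <= l by lra.
  by have := ler_wpM2l l0 (wv s sr); lra.
have dD x : 0 <= x < r -> is_derive x 1 (fun y => w1 y - v1 y) (w2 x - v2 x).
  by move=> xr; exact: is_derive_sub (rs_der2 wsol xr) (rs_der2 vsol xr).
have hD x : 0 < x < r ->
    `|x * (w2 x - v2 x) + (k%:R + 1) * (w1 x - v1 x)| <= (l + 1) * e1 * x.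
  move=> xr; have /andP[x0 x_r] := xr.
  rewrite ode// [X in `|X|](_ : _ = x * h x); last by field; rewrite gt_eqF.
  by rewrite normrM (gtr0_norm x0) mulrC ler_wpM2r ?(ltW x0)// hB// (ltW x0).
have w1v1 := radial_quotient_bound k_ge5 dD hD.
move=> s sr; have /andP[s0 s_r] := sr; have sr' : 0 <= s < r by rewrite (ltW s0).
split.
- exact: le_trans (wv s sr') e1e''.
- by apply: le_trans (w1v1 s sr) _; rewrite ler_wpM2r// ltW.
- rewrite ode//; apply: le_trans (ler_normB _ _) _.
  rewrite normrM normfV (gtr0_norm s0) normrM ger0_norm ?addr_ge0 ?(ltW k0)//.
  have := w1v1 s sr; rewrite -ler_pdivrMr// => a1.
  have k1 : 0 <= k%:R + 1 :> R by rewrite addr_ge0// ltW.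
  have := ler_wpM2l k1 a1; have := hB s sr'.
  by rewrite -e1e; lra.
Qed.

End continuous_dependence.

(** * Compactness *)

Section a_priori_bound.
Context {R : realType} (k : nat) (r : R).
Hypothesis k_ge5 : (5 <= k)%N.
Hypothesis r0 : 0 < r.
Local Notation N := k.+2.

Let k_gt0 : (0 < k)%N. Proof. exact: leq_trans k_ge5. Qed.
Let k0 : 0 < k%:R :> R. Proof. by rewrite ltr0n. Qed.
Let N_R : N%:R = k%:R + 2 :> R. Proof. by rewrite -natrD addn2. Qed.

Lemma sobolev_exponentE : sobolev_exponent N = 2 * (k%:R + 2) / k%:R :> R.
Proof. by rewrite /sobolev_exponent N_R addrK. Qed.

(** At the critical exponent the two arguments of the maximum coincide, and the second one increases
    with p. *)
Lemma alphaE (p : R) : sobolev_exponent N <= p -> alpha N p = N%:R / 2 * (p - 2).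
Proof.
rewrite sobolev_exponentE => pc; rewrite /alpha sobolev_exponentE N_R max_r; first by field.
have h : 4 <= k%:R * (p - 2) by move: pc; rewrite ler_pdivrMr//; lra.
rewrite ler_pdivrMr//.
have k2 : 0 <= (k%:R + 2) / 2 :> R by have := k0; lra.
by have := ler_wpM2l k2 h; lra.
Qed.

Lemma nearly_critical_near (p : nat -> R) :
  (forall n, sobolev_exponent N <= p n) ->
  p n @[n --> \oo] --> (sobolev_exponent N : R) ->
  exists K, forall n, (K <= n)%N -> nearly_critical k (p n).
Proof.
move=> pc plim.
have k5 : 5 <= k%:R :> R by rewrite (ler_nat R 5 k).
have lt : sobolev_exponent N < 2 + 15 / 2 / (k%:R + 25 / 6) :> R.
  rewrite sobolev_exponentE; have k1 : 0 < k%:R + 25 / 6 :> R by lra.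
  rewrite -ltrBlDl ltr_pdivlMr// [ltLHS](_ : _ = (4 * k%:R + 50 / 3) / k%:R); last first.
    by field; rewrite gt_eqF.
  by rewrite ltr_pdivrMr//; lra.
have [K _ HK] := cvgr_lt _ plim _ lt.
exists K => n Kn; split; first by rewrite -sobolev_exponentE.
have k1 : 0 < k%:R + 25 / 6 :> R by lra.
have := HK n Kn; rewrite /= -ltrBlDl ltr_pdivlMr// mulrC => h.
exact: ltW.
Qed.

Lemma amplitude_bound (C : R) : 0 < C -> exists L, forall p (u : 'rV[R]_N -> R),
  nearly_critical k p -> C2_cball r u -> radial r u ->
  (forall x, oball r x -> - laplacian u x + u x = `|u x| `^ (p - 2) * u x) ->
  (Lnorm_ball r (alpha N p) u <= C%:E)%E -> `|profile u 0| <= L.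
Proof.
move=> C0; have [c0 c00 mass] := bubble_mass k_ge5 r0.
(* An upper bound for C^alpha that serves all nearly critical p at once, as alpha = N/2 (p - 2) <=
   N/2. *)
pose C1 := Num.max 1 C `^ (N%:R / 2).
have [J HJ] : exists J : nat, C1 < J.+1%:R * c0.
  have C10 : 0 <= C1 / c0 by rewrite divr_ge0 ?powR_ge0// ltW.
  exists (Num.bound (C1 / c0)); rewrite -ltr_pdivrMr//.
  by apply: lt_le_trans (archi_boundP C10) _; rewrite ler_nat.
have [L HL] := many_bubbles k_ge5 J r0.
exists L => p u pc uC2 urad ueq ubd; rewrite leNgt; apply/negP => /ltW uL.
have /andP[p4 p1] := nearly_criticalP k_ge5 pc.
have p2 := gt2_supercritical k_gt0 (proj1 pc).
have sol := radial_solution_profile r0 uC2 urad ueq.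
have [f [f2 fb]] := HL _ _ _ _ pc sol uL.
have uE x : oball r x -> u x = profile u (enorm x).
  by move=> xr; apply: (profileE urad); exact: ltW.
have := mass _ _ _ _ _ pc sol uE J f f2 fb.
move: ubd; rewrite alphaE ?sobolev_exponentE; last exact: proj1 pc.
set a := _ / 2 * _; rewrite /Lnorm_ball.
set F := (X in Lnorm _ _ X) => ubd.
have N2 : 0 < N%:R / 2 :> R by rewrite divr_gt0 ?ltr0n.
have a0 : 0 < a by rewrite mulr_gt0// subr_gt0.
have aN : a <= N%:R / 2 by rewrite ger_pMr.
have FE := @poweR_Lnorm _ _ _ (lebesgue_tuple N) F a (lt0r_neq0 a0).
move=> h; have {}h : ((J.+1%:R * c0)%:E <= Lnorm (lebesgue_tuple N) a%:E F `^ a)%E.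
  by rewrite FE; apply: le_trans h _; rewrite le_eqVlt; apply/orP; left; apply/eqP;
     apply: eq_integral => t _; rewrite -poweR_EFin.
have : ((J.+1%:R * c0)%:E <= (C1)%:E)%E.
  apply: le_trans h _; apply: (@le_trans _ _ (C%:E `^ a)%E).
    apply: gt0_ler_poweR => //; first exact: ltW.
    - by rewrite in_itv/= Lnorm_ge0 leey.
    - by rewrite in_itv/= leey andbT lee_fin ltW.
  rewrite poweR_EFin lee_fin.
  apply: (@le_trans _ _ (Num.max 1 C `^ a)).
    by rewrite ge0_ler_powR ?nnegrE ?le_max ?lexx ?ler01 ?orbT// ltW.
  by rewrite ler_powR// le_max lexx.
by rewrite lee_fin leNgt HJ.
Qed.

End a_priori_bound.

Section compactness.
Context {R : realType} (k : nat) (r : R).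
Hypothesis k_ge5 : (5 <= k)%N.
Hypothesis r0 : 0 < r.
Local Notation N := k.+2.

Lemma extends_continuously_sub (f g : 'rV[R]_N -> R) :
  extends_continuously r f -> extends_continuously r g ->
  extends_continuously r (fun x => f x - g x).
Proof.
move=> [F cF Ff] [G cG Gg]; exists (fun x => F x - G x) => [|x xr]; last by rewrite Ff ?Gg.
by apply/subspace_continuousP => y yr; apply: cvgB; apply/subspace_continuousP: y yr.
Qed.

(* The formulas for the derivatives of a radial function are singular at the
   origin, where bounds are recovered by continuity. *)
Lemma bound_off_origin (f : 'rV[R]_N -> R) (c : R) : extends_continuously r f ->
  (forall x, oball r x -> x != 0 -> `|f x| <= c) -> forall x, oball r x -> `|f x| <= c.
Proof.
move=> [g /subspace_continuousP cg gf] fc x xr; have [x0|] := eqVneq x 0; last exact: fc.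
rewrite x0 -gf; last by rewrite -x0.
rewrite {}x0 in xr => {x}; apply/ler_addgt0Pr => e e0.
have /cvgrPdist_le /(_ _ e0) := cg _ (ltW xr : cball r (0 : 'rV[R]_N)).
rewrite near_withinE => /nbhs_ballP[d /= d0 Hd].
pose e0' : 'rV[R]_N := delta_mx 0 ord0.
have n1 : 0 < `|e0'| + 1 by rewrite ltr_wpDl.
pose s := Num.min (r / 2) (d / (`|e0'| + 1)).
have s0 : 0 < s by rewrite lt_min !divr_gt0.
have sr : s < r.
  apply: (@le_lt_trans _ _ (r / 2)); first by rewrite ge_min lexx.
  by rewrite ltr_pdivrMr// ltr_pMr// ltr1n.
have en : enorm (s *: e0') = s by rewrite enorm_axis gtr0_norm.
have sb : oball r (s *: e0') by rewrite /oball/= en.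
have sd : ball (0 : 'rV[R]_N) d (s *: e0').
  rewrite -ball_normE/= sub0r normrN normrZ gtr0_norm//.
  apply: (@lt_le_trans _ _ (s * (`|e0'| + 1))); first by rewrite ltr_pM2l// ltrDl.
  by rewrite -ler_pdivlMr// ge_min lexx orbT.
have h1 : `|g 0 - g (s *: e0')| <= e := Hd _ sd (ltW sb).
have := fc _ sb; rewrite -enorm_gt0 en s0 -gf// => /(_ isT).
have := ler_distD (g (s *: e0')) (g 0) 0; rewrite !subr0.
by lra.
Qed.

(** A radial solution is determined in C^2 by its value at the origin and its exponent, with a
    modulus of continuity uniform over bounded values. *)
Lemma radial_C2_cauchy (B e : R) : 1 <= B -> 0 < e -> exists2 d, 0 < d &
  forall p q (u v : 'rV[R]_N -> R), nearly_critical k p -> nearly_critical k q ->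
    C2_cball r u -> C2_cball r v -> radial r u -> radial r v ->
    (forall x, oball r x -> - laplacian u x + u x = `|u x| `^ (p - 2) * u x) ->
    (forall x, oball r x -> - laplacian v x + v x = `|v x| `^ (q - 2) * v x) ->
    `|profile u 0| <= B -> `|profile v 0| <= B ->
    `|profile u 0 - profile v 0| <= d -> `|p - q| <= d ->
  forall x, oball r x -> [/\ `|u x - v x| <= e,
    forall i, `|partial i u x - partial i v x| <= e &
    forall i j, `|partial j (partial i u) x - partial j (partial i v) x| <= e].
Proof.
move=> B1 e0; pose B' := Num.max (3 `^ (k%:R / 4)) (2 * B).
have B'1 : 1 <= B' by rewrite le_max; apply/orP; right; lra.
(* e/3 serves the three terms of a difference of Hessians; e/r serves the gradients, which differ by
   at most e1 |x| <= e1 r. *)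
pose e1 := Num.min (e / 3) (e / r).
have e10 : 0 < e1 by rewrite lt_min !divr_gt0.
have e13 : 3 * e1 <= e by have : e1 <= e / 3 by [rewrite ge_min lexx]; lra.
have e1r : e1 * r <= e by rewrite -ler_pdivlMr// ge_min lexx orbT.
have [d d0 Hd] := continuous_dependence r k_ge5 B'1 e10.
exists d => // p q u v pc qc uC2 vC2 urad vrad ueq veq uB vB uv0 pq.
have usol := radial_solution_profile r0 uC2 urad ueq.
have vsol := radial_solution_profile r0 vC2 vrad veq.
have bnd t (w w1 w2 : R -> R) : nearly_critical k t -> radial_solution k r t w w1 w2 ->
    `|w 0| <= B -> forall s, 0 <= s < r -> `|w s| <= B'.
  move=> tc sol wB s sr; apply: le_trans (profile_sup_bound k_ge5 tc sol sr) _.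
  rewrite ge_max le_max lexx/= le_max; apply/orP; right; lra.
have {}Hd := Hd _ _ _ _ _ _ _ _ pc qc usol vsol (bnd _ _ _ _ pc usol uB)
  (bnd _ _ _ _ qc vsol vB) uv0 pq.
have [ucont _ _ du ddu] := uC2; have [vcont _ _ dv ddv] := vC2.
have en (x : 'rV[R]_N) : oball r x -> x != 0 -> 0 < enorm x < r.
  by move=> xr x0; rewrite enorm_gt0 x0.
have frac (x : 'rV[R]_N) i : x != 0 -> `|x 0 i / enorm x| <= 1.
  rewrite -enorm_gt0 => x0; rewrite normrM normfV (gtr0_norm x0) ler_pdivrMr// mul1r.
  exact: normr_le_enorm.
have ext (w : 'rV[R]_N -> R) : {within cball r, continuous w} -> extends_continuously r w.
  by move=> cw; exists w.
have q1 (x : 'rV[R]_N) : oball r x -> x != 0 ->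
    `|profile1 u (enorm x) / enorm x - profile1 v (enorm x) / enorm x| <= e1.
  move=> xr x0; have xr' := en x xr x0; have [_ h _] := Hd _ xr'.
  have /andP[xp _] := xr'.
  by rewrite -mulrBl normrM normfV (gtr0_norm xp) ler_pdivrMr.
move=> x xr; split.
- apply: (bound_off_origin (f := fun x => u x - v x) _ _ xr) => [|{xr}x xr x0].
    by apply: extends_continuously_sub; exact: ext.
  rewrite (profileE urad) ?(profileE vrad) ?/cball/= ?ltW//.
  by have [h _ _] := Hd _ (en x xr x0); lra.
- move=> i; apply: (bound_off_origin (f := fun x => partial i u x - partial i v x) _ _ xr) => [|{xr}x xr x0].
    exact: extends_continuously_sub.
  rewrite (partial_radial r0 uC2 urad)// (partial_radial r0 vC2 vrad)// -mulrBl normrM.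
  have xr' := en x xr x0; have [_ h _] := Hd _ xr'; have /andP[xp xr''] := xr'.
  apply: le_trans e1r; apply: (@le_trans _ _ (e1 * enorm x * 1)).
    by rewrite ler_pM// frac.
  by rewrite mulr1 ler_wpM2l// ltW.
- move=> i j; apply: (bound_off_origin (f := fun x => partial j (partial i u) x - partial j (partial i v) x) _ _ xr) => [|{xr}x xr x0].
    exact: extends_continuously_sub.
  rewrite (partial2_radial r0 uC2 urad)// (partial2_radial r0 vC2 vrad)//.
  have [_ _ h] := Hd _ (en x xr x0); have hq := q1 x xr x0.
  set X := x 0 i / enorm x * (x 0 j / enorm x).
  have X1 : `|X| <= 1 by rewrite normrM mulr_ile1 ?frac.
  have D1 : `|(i == j)%:R : R| <= 1 by case: (i == j); rewrite ?normr1 ?normr0.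
  move: h hq X1 D1; move: (profile2 u _) (profile2 v _) (profile1 u _ / _) (profile1 v _ / _) X (_%:R : R).
  move=> a b a' b' X D ab a'b' X1 D1.
  rewrite [X in `|X|](_ : _ = (a - b) * X - (a' - b') * X + D * (a' - b')); last by ring.
  have m1 : `|(a - b) * X| <= e1 by rewrite normrM -[leRHS]mulr1 ler_pM.
  have m2 : `|(a' - b') * X| <= e1 by rewrite normrM -[leRHS]mulr1 ler_pM.
  have m3 : `|D * (a' - b')| <= e1 by rewrite normrM -[leRHS]mul1r ler_pM.
  apply: le_trans (ler_normD _ _) _.
  by have := ler_normB ((a - b) * X) ((a' - b') * X); lra.
Qed.

End compactness.

Theorem theorem1p1 (R : realType) (N : nat) (hN : (7 <= N)%N)
    (r : R) (hr : 0 < r)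
    (p : nat -> R)
    (hp : forall k, sobolev_exponent N <= p k)
    (hplim : p k @[k --> \oo] --> (sobolev_exponent N : R))
    (u : nat -> 'rV[R]_N -> R)
    (huC2 : forall k, C2_cball r (u k))
    (hurad : forall k, radial r (u k))
    (heq : forall k x, oball r x ->
      - laplacian (u k) x + u k x = `|u k x| `^ (p k - 2) * u k x)
    (hbd : forall k x, esphere r x -> normal_derivative r (u k) x = 0)
    (C : R) (hC : 0 < C)
    (hbound : forall k, (Lnorm_ball r (alpha N (p k)) (u k) <= C%:E)%E) :
  C2_precompact r u.
Proof.
case: N hN hp hplim u huC2 hurad heq hbd hbound => [//|[//|k]] hk hp plim u uC2 urad ueq _ ubd.
have k5 : (5 <= k)%N by [].
have [K nc] := nearly_critical_near k5 hp plim.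
have [L HL] := amplitude_bound k5 hr hC.
move=> phi phi_incr.
have incr_ge (h : nat -> nat) : increasing_seq h -> forall n, (n <= h n)%N.
  move=> h_incr; elim=> // n IH; apply: leq_ltn_trans IH _.
  have hE : (h n.+1 <= h n)%N = (n.+1 <= n)%N := h_incr n.+1 n.
  by rewrite ltnNge hE -ltnNge.
have phi_ge := incr_ge phi phi_incr.
have K_phi n : (K <= phi (n + K)%N)%N.
  by apply: leq_trans (phi_ge _); exact: leq_addl.
(* The shift by [K] skips the finitely many exponents that may fail to be nearly critical; it
   reappears in the extracted subsequence. *)
pose m n := profile (u (phi (n + K)%N)) 0.
have mL n : `|m n| <= L.
  exact: (HL (p (phi (n + K)%N)) _ (nc _ (K_phi n)) (uC2 _) (urad _) (ueq _) (ubd _)).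
have bm : bounded_fun m.
  by exists L; split => [|M LM n _]; [exact: num_real|apply: le_trans (mL n) (ltW LM)].
have [f f_incr cf] := bolzano_weierstrass bm.
exists (fun n => (f n + K)%N) => [i j|].
  have fE : (f i <= f j)%N = (i <= j)%N := f_incr i j.
  by rewrite !leEnat leq_add2r fE.
have f_ge := incr_ge f f_incr.
pose s n := phi (f n + K)%N.
have s_ge n : (n <= s n)%N.
  by apply: leq_trans (phi_ge _); apply: leq_trans (f_ge n) (leq_addr _ _).
pose B := Num.max 1 L; have B1 : 1 <= B by rewrite le_max lexx.
have mB n : `|profile (u (s n)) 0| <= B by rewrite le_max; apply/orP; right; exact: mL.
have cauchy e : 0 < e -> exists M, forall i j x, (M <= i)%N -> (M <= j)%N -> oball r x ->
    [/\ `|u (s i) x - u (s j) x| <= e,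
      forall a, `|partial a (u (s i)) x - partial a (u (s j)) x| <= e &
      forall a b, `|partial b (partial a (u (s i))) x - partial b (partial a (u (s j))) x| <= e].
  move=> e0; have [d d0 Hd] := radial_C2_cauchy k5 hr B1 e0.
  have d2 : 0 < d / 2 by rewrite divr_gt0.
  have /cvgrPdist_le /(_ _ d2) [M1 _ HM1] := cf.
  have /cvgrPdist_le /(_ _ d2) [M2 _ HM2] := plim.
  exists (maxn M1 M2) => i j x; rewrite !geq_max => /andP[i1 i2] /andP[j1 j2] xr.
  apply: (Hd (p (s i)) (p (s j)) _ _ (nc _ (K_phi _)) (nc _ (K_phi _)) (uC2 _) (uC2 _)
    (urad _) (urad _) (ueq _) (ueq _) (mB _) (mB _)) => //.
    have h1 := HM1 i i1; have h2 := HM1 j j1.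
    apply: le_trans (ler_distD (lim ((m \o f) n @[n --> \oo])) _ _) _.
    by rewrite [leRHS]splitr; apply: lerD => //; rewrite distrC.
  have h1 := HM2 _ (leq_trans i2 (s_ge i)); have h2 := HM2 _ (leq_trans j2 (s_ge j)).
  apply: le_trans (ler_distD (sobolev_exponent k.+2) _ _) _.
  by rewrite [leRHS]splitr; apply: lerD => //; rewrite distrC.
apply: (@C2_complete _ _ r hr (fun n => u (s n))).
- by move=> n; exact: uC2.
- by move=> e /cauchy[M HM]; exists M => i j x iM jM xr; have [] := HM i j x iM jM xr.
- by move=> a e /cauchy[M HM]; exists M => i j x iM jM xr; have [_ h _] := HM i j x iM jM xr.
- by move=> a b e /cauchy[M HM]; exists M => i j x iM jM xr; have [_ _ h] := HM i j x iM jM xr.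
Qed.
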